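(* Let $\ell$ be a commutative ring with unit and let $G$ be a group. (1) The functor $j^G:G\mathbf{Alg}\to kk^G$ is $G$-Morita invariant: $j^G(R)\cong j^G(S)$ in $kk^G$ whenever $R$ and $S$ are $G$-Morita equivalent unital $G$-algebras. (2) The functor $j^G_{\mathrm{gr}}:G_{\mathrm{gr}}\mathbf{Alg}\to kk^G_{\mathrm{gr}}$ is $G$-graded Morita invariant: $j^G_{\mathrm{gr}}(R)\cong j^G_{\mathrm{gr}}(S)$ in $kk^G_{\mathrm{gr}}$ whenever $R$ and $S$ are $G$-graded Morita equivalent unital $G$-graded algebras.
   Context: Algebras are associative, not necessarily unital $\ell$-algebras; $\otimes=\otimes_\ell$ unless another ring is indicated. For a set $S$, $M_S$ is the algebra of finitely supported $S\times S$ matrices over $\ell$, with matrix units $E_{s,t}$. $G$-algebras. A $G$-algebra is an algebra with an action of $G$ by algebra automorphisms; $G\mathbf{Alg}$ is the category of $G$-algebras and equivariant (not necessarily unital) homomorphisms. A $G$-algebra is unital if it has a unit $1$ and $g\cdot1=1$ for all $g$. For a $G$-set $S$, $M_SA=M_S\otimes A$ has action $g\cdot(E_{s,t}\otimes a)=E_{g\cdot s,g\cdot t}\otimes g\cdot a$; an injective equivariant $f:S\to T$ induces $f_*:M_SA\to M_TA$, $E_{s,t}\otimes a\mapsto E_{f(s),f(t)}\otimes a$. A functor on $G\mathbf{Alg}$ is $G$-stable if it inverts $f_*:M_SA\to M_TA$ for every $A$ and every injective equivariant $f:S\to T$ with $S\ne\emptyset$ and $\operatorname{card}(T)\le\operatorname{card}(G)+1$.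 $G$-Morita equivalence of unital $G$-algebras $R,S$: a tuple $(R,S,P,Q,\alpha,\beta)$ with $P$ an $S$-$R$-bimodule and $Q$ an $R$-$S$-bimodule, both $G$-modules with $g\cdot(s\cdot p\cdot r)=(g\cdot s)\cdot(g\cdot p)\cdot(g\cdot r)$, $g\cdot(r\cdot q\cdot s)=(g\cdot r)\cdot(g\cdot q)\cdot(g\cdot s)$, and $\alpha:P\otimes_RQ\to S$, $\beta:Q\otimes_SP\to R$ bimodule isomorphisms, equivariant for the diagonal actions, with $\alpha(p\otimes q)\cdot p'=p\cdot\beta(q\otimes p')$ and $\beta(q\otimes p)\cdot q'=q\cdot\alpha(p\otimes q')$. $G$-graded algebras. A $G$-graded algebra is $A=\bigoplus_gA_g$ with $A_gA_h\subseteq A_{gh}$; $|a|=g$ means $a\in A_g$; $G_{\mathrm{gr}}\mathbf{Alg}$ has as morphisms the degree-preserving (not necessarily unital) homomorphisms. It is unital if it has a unit with $|1|=e$. A $G$-graded set is a set $S$ with a function $\phi:S\to G$; morphisms are functions compatible with the maps to $G$. $M_S(A)$ is $M_S\otimes A$ graded by $|E_{s,t}\otimes a|=\phi(s)|a|\phi(t)^{-1}$; injective morphisms $f:S\to T$ induce $f_*:M_S(A)\to M_T(A)$, $E_{s,t}\otimes a\mapsto E_{f(s),f(t)}\otimes a$. A functor on $G_{\mathrm{gr}}\mathbf{Alg}$ is $G$-graded stable if it inverts $f_*:M_S(A)\to M_T(A)$ for every $A$ and every injective morphism of $G$-graded sets $f:S\to T$ with $S\neq\emptyset$ and $\operatorname{card}(T)\le\operatorname{card}(G)$.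 $G$-graded Morita equivalence of unital $G$-graded algebras $R,S$: a tuple $(R,S,P,Q,\alpha,\beta)$ with $P$ a $G$-graded $S$-$R$-bimodule, $Q$ a $G$-graded $R$-$S$-bimodule, $|s\cdot p\cdot r|=|s||p||r|$, $|r\cdot q\cdot s|=|r||q||s|$, and $\alpha:P\otimes_RQ\to S$, $\beta:Q\otimes_SP\to R$ degree-preserving bimodule isomorphisms (with $|p\otimes q|=|p||q|$, $|q\otimes p|=|q||p|$) satisfying the mixed associativity relations $\alpha(p\otimes q)\cdot p'=p\cdot\beta(q\otimes p')$ and $\beta(q\otimes p)\cdot q'=q\cdot\alpha(p\otimes q')$. Bivariant $K$-theory. Let $\mathbf{A}$ be $G\mathbf{Alg}$ or $G_{\mathrm{gr}}\mathbf{Alg}$. A functor on $\mathbf{A}$ is homotopy invariant if it inverts the inclusion of constants $A\to A[t]$ for all $A$ (with trivial action on $t$, resp. $|t|=e$). It is $M_{\mathbb N}$-stable if it inverts $A\to M_{\mathbb N}A$, $a\mapsto E_{1,1}\otimes a$, for all $A$, where $G$ acts on coefficients only, resp. $|E_{i,j}\otimes a|=|a|$. An extension is a short exact sequence $A\to B\to C$ in $\mathbf{A}$ that admits an $\ell$-linear section $C\to B$ that is $G$-equivariant, resp. degree-preserving. A functor $X$ from $\mathbf{A}$ to a triangulated category $(\mathcal{T},\Omega)$, $\Omega$ being the desuspension, is excisive if it is equipped with morphisms $\partial_{\mathcal E}:\Omega X(C)\to X(A)$, one for each extension $\mathcal E: A\to B\to C$, natural with respect to morphisms of extensions, such that $\Omega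 X(C)\to X(A)\to X(B)\to X(C)$ is a distinguished triangle. The functor $j^G:G\mathbf{Alg}\to kk^G$ (resp. $j^G_{\mathrm{gr}}:G_{\mathrm{gr}}\mathbf{Alg}\to kk^G_{\mathrm{gr}}$) is the initial one among the functors to triangulated categories that are homotopy invariant, excisive, $M_{\mathbb N}$-stable and $G$-stable (resp. $G$-graded stable): any other such functor factors uniquely through it via a triangulated functor compatible with the boundary morphisms. *)

(* Defs.v *)
From HB Require Import structures.
From mathcomp Require Import all_boot all_algebra all_classical generic_quotient.

Set Implicit Arguments.
Unset Strict Implicit.
Unset Printing Implicit Defensive.

Import GRing.Theory.
Local Open Scope classical_set_scope.
Local Open Scope ring_scope.
Local Open Scope quotient_scope.

Section FinSupp.
Variables (l : pzRingType) (I : choiceType) (V : lmodType l).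

Definition finite_supp : {pred I -> V} :=
  fun f => `[< finite_set [set i | f i != 0] >].

Lemma finite_suppP (f : I -> V) :
  reflect (exists r : seq I, forall i, f i != 0 -> i \in r) (f \in finite_supp).
Proof.
apply: (iffP (asboolP _)) => [/finite_seqP [r e]|[r h]].
  by exists r => i fi; have : [set` r] i by rewrite -e.
by apply: (sub_finite_set _ (finite_seq r)) => i /h.
Qed.

Lemma finite_supp_submod : GRing.subsemimod_closed (finite_supp).
Proof.
split; first split.
- by apply/finite_suppP; exists [::] => i; rewrite eqxx.
- move=> f g /finite_suppP [r fr] /finite_suppP [s gs].
  apply/finite_suppP; exists (r ++ s) => i; rewrite mem_cat.
  apply: contraR; rewrite negb_or => /andP [ir is'].
  rewrite [(f + g) i](_ : _ = f i + g i) //.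
  have /eqP -> : f i == 0 by apply: contraR ir => /fr.
  have /eqP -> : g i == 0 by apply: contraR is' => /gs.
  by rewrite addr0.
- move=> a f /finite_suppP [r fr].
  apply/finite_suppP; exists r => i; rewrite [(a *: f) i](_ : _ = a *: f i) //.
  by move=> h; apply: fr; apply: contraNneq h => ->; rewrite scaler0.
Qed.

HB.instance Definition _ :=
  GRing.isSubSemiModClosed.Build l (I -> V) (finite_supp) finite_supp_submod.

Record finsupp := FinSupp { finsupp_fun :> I -> V; _ : finsupp_fun \in finite_supp }.

HB.instance Definition _ := [isSub for finsupp_fun].
HB.instance Definition _ := [Choice of finsupp by <:].
HB.instance Definition _ := [SubChoice_isSubLmodule of finsupp by <:].
End FinSupp.
Arguments finite_supp {l} I V.

Section FinSuppTheory.
Variables (l : pzRingType) (I : choiceType) (V : lmodType l).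
Implicit Types f g : finsupp I V.

Lemma finsupp_ext f g : (forall i, f i = g i) -> f = g.
Proof. by move=> h; apply: val_inj; apply/funext. Qed.

Lemma finsupp_seq f : exists r : seq I, forall i, f i != 0 -> i \in r.
Proof. by case: f => f /= /finite_suppP. Qed.

Lemma finsuppD f g i : (f + g) i = f i + g i. Proof. by []. Qed.
Lemma finsuppZ a f i : (a *: f) i = a *: f i. Proof. by []. Qed.
Lemma finsupp0 i : (0 : finsupp I V) i = 0. Proof. by []. Qed.

Lemma fsum_seq (F : I -> V) (r : seq I) :
  uniq r -> (forall i, F i != 0 -> i \in r) ->
  \sum_(i \in [set: I]) F i = \sum_(i <- r) F i.
Proof.
move=> ur h; rewrite (fsbigE r) //; last first.
  by move=> i _ ir; apply/eqP; apply: contraR ir => /h.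
by apply: eq_bigl => i; rewrite mem_setT.
Qed.

Definition finsupp_single_fun (i : I) (v : V) : I -> V :=
  fun j => if j == i then v else 0.

Lemma finsupp_single_subproof i v : finsupp_single_fun i v \in finite_supp I V.
Proof.
apply/finite_suppP; exists [:: i] => j; rewrite /finsupp_single_fun inE.
by case: (j == i) => //; rewrite eqxx.
Qed.

Definition finsupp_single i v := FinSupp (finsupp_single_subproof i v).

Lemma finsupp_singleE i v j : finsupp_single i v j = if j == i then v else 0.
Proof. by []. Qed.
End FinSuppTheory.

(* Associative algebras, not necessarily unital; the ground ring and the algebras
   may be zero, hence comPzRingType and no use of the ring structures. *)
Record algebra (l : comPzRingType) := Algebra {
  alg_mod :> lmodType l;
  amul : alg_mod -> alg_mod -> alg_mod;
  amulA : associative amul;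
  amulDl : left_distributive amul +%R;
  amulDr : right_distributive amul +%R;
  amulZl : forall k a b, amul (k *: a) b = k *: amul a b;
  amulZr : forall k a b, amul a (k *: b) = k *: amul a b }.

Notation "a ** b" := (amul a b) (at level 40, left associativity).

Definition is_unit (l : comPzRingType) (A : algebra l) (e : A) : Prop :=
  forall a : A, e ** a = a /\ a ** e = a.

Record alg_hom (l : comPzRingType) (A B : algebra l) := AlgHom {
  alg_hom_fun :> A -> B;
  alg_hom_linear : linear alg_hom_fun;
  alg_homM : forall a b, alg_hom_fun (a ** b) = alg_hom_fun a ** alg_hom_fun b }.

HB.instance Definition _ (l : comPzRingType) (A B : algebra l) (f : alg_hom A B) :=
  GRing.isLinear.Build l A B *:%R f (alg_hom_linear f).

Section AlgTheory.
Variable l : comPzRingType.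
Implicit Types A B C : algebra l.

Lemma amul0l A (a : A) : 0 ** a = 0.
Proof. by rewrite -[0 in LHS](scale0r 0) amulZl scale0r. Qed.
Lemma amul0r A (a : A) : a ** 0 = 0.
Proof. by rewrite -[0 in LHS](scale0r 0) amulZr scale0r. Qed.

Lemma amul_suml A (J : Type) (r : seq J) (P : pred J) (F : J -> A) a :
  (\sum_(j <- r | P j) F j) ** a = \sum_(j <- r | P j) (F j ** a).
Proof.
elim/big_rec2: _ => [|j x y _ <-]; first by rewrite amul0l.
by rewrite amulDl.
Qed.

Lemma amul_sumr A (J : Type) (r : seq J) (P : pred J) (F : J -> A) a :
  a ** (\sum_(j <- r | P j) F j) = \sum_(j <- r | P j) (a ** F j).
Proof.
elim/big_rec2: _ => [|j x y _ <-]; first by rewrite amul0r.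
by rewrite amulDr.
Qed.

Lemma alg_hom_ext A B (f g : alg_hom A B) : (forall a, f a = g a) -> f = g.
Proof.
case: f g => [f fl fm] [g gl gm] /= /funext fg; subst g.
by congr AlgHom; apply: Prop_irrelevance.
Qed.

Definition alg_hom_id A : alg_hom A A.
Proof. by exists idfun. Defined.

Definition alg_hom_comp A B C (g : alg_hom B C) (f : alg_hom A B) : alg_hom A C.
Proof.
exists (g \o f) => [k a b|a b] /=; first by rewrite !linearP.
by rewrite !alg_homM.
Defined.
End AlgTheory.

Section Matrices.
Variables (l : comPzRingType) (S : choiceType) (A : algebra l).

(* M_S (x) A is represented by the finitely supported functions S * S -> A:
   E_{s,t} (x) a is the function with value a at (s, t) and 0 elsewhere. *)
Definition mat := finsupp (S * S)%type A.
HB.instance Definition _ := GRing.Lmodule.on mat.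
Implicit Types M N : mat.

Lemma mat_seq M : exists r : seq S, forall s t, M (s, t) != 0 -> s \in r /\ t \in r.
Proof.
have [r h] := finsupp_seq M; exists (unzip1 r ++ unzip2 r) => s t /h st.
by rewrite !mem_cat; split; apply/orP; [left|right]; apply/mapP; exists (s, t).
Qed.

Definition mat_mul_fun M N : S * S -> A :=
  fun p => \sum_(u \in [set: S]) (M (p.1, u) ** N (u, p.2)).

Lemma mat_mul_funE M N (r : seq S) s t : uniq r ->
  (forall u, M (s, u) != 0 -> N (u, t) != 0 -> u \in r) ->
  mat_mul_fun M N (s, t) = \sum_(u <- r) (M (s, u) ** N (u, t)).
Proof.
move=> ur h; apply: fsum_seq => // u /= nz; apply: h.
  by apply: contraNneq nz => ->; rewrite amul0l.
by apply: contraNneq nz => ->; rewrite amul0r.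
Qed.

Lemma mat_mul_subproof M N : mat_mul_fun M N \in finite_supp (S * S)%type A.
Proof.
have [r hr] := mat_seq M; have [q hq] := mat_seq N.
apply/finite_suppP; exists [seq (s, t) | s <- r, t <- q] => -[s t].
apply: contraR => /allpairsP nst.
rewrite (@mat_mul_funE _ _ (undup r)) ?undup_uniq ?big1 //.
- move=> u _; apply/eqP; apply: contra_notT nst => nz; exists (s, t) => /=.
  have [|sr _] := hr s u; first by apply: contraNneq nz => ->; rewrite amul0l.
  have [|_ tq] := hq u t; first by apply: contraNneq nz => ->; rewrite amul0r.
  by [].
- by move=> u /hr [_ ur] _; rewrite mem_undup.
Qed.

Definition mat_mul M N : mat := FinSupp (mat_mul_subproof M N).

Lemma mat_mulE M N (r : seq S) s t : uniq r ->
  (forall u, M (s, u) != 0 -> N (u, t) != 0 -> u \in r) ->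
  mat_mul M N (s, t) = \sum_(u <- r) (M (s, u) ** N (u, t)).
Proof. exact: mat_mul_funE. Qed.

Lemma mat_mul_idx M (r0 : seq S) : exists r : seq S, [/\ uniq r,
  forall s t, M (s, t) != 0 -> s \in r /\ t \in r & {subset r0 <= r}].
Proof.
have [r hr] := mat_seq M; exists (undup (r ++ r0)); split.
- exact: undup_uniq.
- by move=> s t /hr []; rewrite !mem_undup !mem_cat => -> ->.
- by move=> u; rewrite mem_undup mem_cat => ->; rewrite orbT.
Qed.

Lemma mat_mulA : associative mat_mul.
Proof.
move=> M N K; apply: finsupp_ext => -[s t].
have [r1 [_ hM _]] := mat_mul_idx M [::].
have [r2 [_ hN s12]] := mat_mul_idx N r1.
have [r [ur hK s2r]] := mat_mul_idx K r2.
have hM' a b : M (a, b) != 0 -> b \in r by case/hM => _ /s12 /s2r.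
have hN' a b : N (a, b) != 0 -> a \in r /\ b \in r.
  by case/hN => /s2r ar /s2r br.
rewrite (mat_mulE ur) => [|u /hM' //].
rewrite (mat_mulE (r := r)) // => [|u _ /hK []//].
under eq_bigr => u _.
  rewrite (mat_mulE (r := r)) // => [|v /hN' [] //].
  rewrite amul_sumr; over.
rewrite exchange_big /=; apply: eq_bigr => u _.
rewrite (mat_mul_funE (r := r)) // => [|v /hM' //].
by rewrite amul_suml; apply: eq_bigr => v _; rewrite amulA.
Qed.

Lemma mat_mulDl : left_distributive mat_mul +%R.
Proof.
move=> M N K; apply: finsupp_ext => -[s t].
have [r [ur hK _]] := mat_mul_idx K [::].
rewrite finsuppD !(mat_mulE (r := r)) //; try by move=> u _ /hK [].
by rewrite -big_split /=; apply: eq_bigr => u _; rewrite -amulDl.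
Qed.

Lemma mat_mulDr : right_distributive mat_mul +%R.
Proof.
move=> M N K; apply: finsupp_ext => -[s t].
have [r [ur hM _]] := mat_mul_idx M [::].
rewrite finsuppD !(mat_mulE (r := r)) //; try by move=> u /hM [].
by rewrite -big_split /=; apply: eq_bigr => u _; rewrite -amulDr.
Qed.

Lemma mat_mulZl (k : l) M N : mat_mul (k *: M) N = k *: mat_mul M N.
Proof.
apply: finsupp_ext => -[s t]; have [r [ur hN _]] := mat_mul_idx N [::].
rewrite finsuppZ !(mat_mulE (r := r)) //; try by move=> u _ /hN [].
by rewrite scaler_sumr; apply: eq_bigr => u _; rewrite -amulZl.
Qed.

Lemma mat_mulZr (k : l) M N : mat_mul M (k *: N) = k *: mat_mul M N.
Proof.
apply: finsupp_ext => -[s t]; have [r [ur hM _]] := mat_mul_idx M [::].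
rewrite finsuppZ !(mat_mulE (r := r)) //; try by move=> u /hM [].
by rewrite scaler_sumr; apply: eq_bigr => u _; rewrite -amulZr.
Qed.

Definition mat_alg : algebra l :=
  @Algebra l mat mat_mul mat_mulA mat_mulDl mat_mulDr mat_mulZl mat_mulZr.

Definition mat_unit (s t : S) (a : A) : mat_alg := finsupp_single (s, t) a.

Lemma mat_unitE s t a s' t' :
  mat_unit s t a (s', t') = if (s' == s) && (t' == t) then a else 0.
Proof. by []. Qed.

Lemma mat_unitM s t u v a b :
  mat_unit s t a ** mat_unit u v b = if t == u then mat_unit s v (a ** b) else 0.
Proof.
apply: finsupp_ext => -[s' v'].
rewrite [LHS](@mat_mulE _ _ [:: t]) // => [|w]; last first.
  by rewrite mat_unitE inE; case: (w == t) => //; rewrite andbF eqxx.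
rewrite big_seq1 !mat_unitE eqxx andbT.
case: (t == u); rewrite ?mat_unitE /=; last by rewrite amul0r.
case: (s' == s); case: (v' == v) => //=; rewrite ?amul0l ?amul0r //.
Qed.
End Matrices.

Section MatMap.
Variables (l : comPzRingType) (S T : choiceType) (A : algebra l).
Variables (f : S -> T) (f_inj : injective f).

(* The sum has at most one term; mat_map_unit gives E_{s,t} (x) a |-> E_{f s,f t} (x) a. *)
Definition mat_map_fun (M : mat_alg S A) : T * T -> A :=
  fun q => \sum_(p \in [set p : S * S | (f p.1, f p.2) = q]) M p.

Lemma mat_map_fun_out M q : (forall s t, (f s, f t) <> q) -> mat_map_fun M q = 0.
Proof. by move=> h; apply: fsbig1 => -[s t] /h. Qed.

Lemma mat_map_fun_in M s t : mat_map_fun M (f s, f t) = M (s, t).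
Proof.
rewrite /mat_map_fun (_ : [set _ | _] = [set (s, t)]) ?fsbig_set1 //.
apply/seteqP; split => [[s' t'] /= [/f_inj -> /f_inj ->]|[s' t'] /= [-> ->]] //.
Qed.

Lemma mat_map_subproof M : mat_map_fun M \in finite_supp (T * T)%type A.
Proof.
have [r h] := finsupp_seq M.
apply/finite_suppP; exists [seq (f p.1, f p.2) | p <- r] => q nz.
have [[s t] e] : exists p, (f p.1, f p.2) = q.
  apply: contrapT => ne; move/eqP: nz; apply; apply: mat_map_fun_out => s t e.
  by apply: ne; exists (s, t).
apply/mapP; exists (s, t) => //; apply: h.
by move: nz; rewrite -e mat_map_fun_in.
Qed.

Definition mat_map_val (M : mat_alg S A) : mat_alg T A := FinSupp (mat_map_subproof M).

Lemma mat_mapE M s t : mat_map_val M (f s, f t) = M (s, t).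
Proof. exact: mat_map_fun_in. Qed.

Lemma mat_map_out M q : (forall s t, (f s, f t) <> q) -> mat_map_val M q = 0.
Proof. exact: mat_map_fun_out. Qed.

Lemma mat_map_linear : linear mat_map_val.
Proof.
move=> k M N; apply: finsupp_ext => q.
case: (pselect (exists p, (f p.1, f p.2) = q)) => [[[s t] <-]|ne].
  by rewrite finsuppD finsuppZ !mat_mapE.
have h s t : (f s, f t) <> q by move=> e; apply: ne; exists (s, t).
by rewrite finsuppD finsuppZ !mat_map_out // scaler0 addr0.
Qed.

Lemma mat_mapM M N : mat_map_val (M ** N) = mat_map_val M ** mat_map_val N.
Proof.
apply: finsupp_ext => -[s' t'].
have [r [ur hM _]] := mat_mul_idx M [::].
have ufr : uniq [seq f s | s <- r] by rewrite map_inj_uniq.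
rewrite [RHS](mat_mulE ufr) => [|u' nM _]; last first.
  case: (pselect (exists p, (f p.1, f p.2) = (s', u'))) => [[[s u] [e1 e2]]|ne].
    rewrite -e2 map_f //; move: nM; rewrite -e1 -e2 mat_mapE => /hM [] //.
  by case/eqP: nM; apply: mat_map_out => s t e; apply: ne; exists (s, t).
rewrite big_map.
case: (pselect (exists s, f s = s')) => [[s <-]|ns]; last first.
  rewrite mat_map_out; last by move=> s t [e _]; apply: ns; exists s.
  rewrite big1 // => u _; rewrite mat_map_out ?amul0l // => s t [e _].
  by apply: ns; exists s.
case: (pselect (exists t, f t = t')) => [[t <-]|nt]; last first.
  rewrite mat_map_out; last by move=> s0 t [_ e]; apply: nt; exists t.
  rewrite big1 // => u _; rewrite [X in _ ** X]mat_map_out ?amul0r // => s0 t [_ e].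
  by apply: nt; exists t.
rewrite mat_mapE [LHS](mat_mulE ur) => [|u /hM []//].
by apply: eq_bigr => u _; rewrite !mat_mapE.
Qed.

Definition mat_map : alg_hom (mat_alg S A) (mat_alg T A) :=
  AlgHom mat_map_linear mat_mapM.

Lemma mat_map_unit s t a : mat_map (mat_unit s t a) = mat_unit (f s) (f t) a.
Proof.
apply: finsupp_ext => -[s' t']; rewrite [RHS]mat_unitE.
case: (pselect (exists p, (f p.1, f p.2) = (s', t'))) => [[[u v] [<- <-]]|ne].
  by rewrite [LHS]mat_mapE mat_unitE !(inj_eq f_inj).
rewrite [LHS]mat_map_out => [|u v e]; last by apply: ne; exists (u, v).
case: (s' =P f s) => //= es; case: (t' =P f t) => //= et.
by case: ne; exists (s, t); rewrite es et.
Qed.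
End MatMap.

Section MatUnitHom.
Variables (l : comPzRingType) (S : choiceType) (A : algebra l) (s : S).

Lemma mat_unit_linear : linear (@mat_unit l S A s s).
Proof.
move=> k a b; apply: finsupp_ext => -[u v].
rewrite finsuppD finsuppZ !mat_unitE; case: ifP => // _.
by rewrite scaler0 addr0.
Qed.

Lemma mat_unit_mul a b : mat_unit s s (a ** b) = mat_unit s s a ** mat_unit s s b :> mat_alg S A.
Proof. by rewrite mat_unitM eqxx. Qed.

Definition mat_incl : alg_hom A (mat_alg S A) := AlgHom mat_unit_linear mat_unit_mul.
End MatUnitHom.

Section Polynomials.
Variables (l : comPzRingType) (A : algebra l).

(* A[t]: the value at n is the coefficient of t^n. *)
Definition apoly := finsupp nat A.
HB.instance Definition _ := GRing.Lmodule.on apoly.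
Implicit Types p q : apoly.

Lemma apoly_bound p : exists n, forall i, (n <= i)%N -> p i = 0.
Proof.
have [r h] := finsupp_seq p; exists (\max_(i <- r) i).+1 => i lt.
apply/eqP; apply: contraTT lt => /h ir; rewrite -leqNgt.
by rewrite (big_rem i) //= leq_maxl.
Qed.

Definition apoly_mul_fun p q : nat -> A :=
  fun n => \sum_(i < n.+1) (p i ** q (n - i)%N).

Lemma apoly_mul_subproof p q : apoly_mul_fun p q \in finite_supp nat A.
Proof.
have [m hp] := apoly_bound p; have [n hq] := apoly_bound q.
apply/finite_suppP; exists (iota 0 (m + n)) => k.
rewrite mem_iota add0n /=; apply: contraR; rewrite -leqNgt => mnk.
apply/eqP; apply: big1 => i _; have [mi|im] := leqP m i.
  by rewrite hp // amul0l.
rewrite hq ?amul0r // leq_subRL; last by rewrite -ltnS.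
by apply: leq_trans mnk; rewrite leq_add2r ltnW.
Qed.

Definition apoly_mul p q : apoly := FinSupp (apoly_mul_subproof p q).

Lemma apoly_mulE p q n : apoly_mul p q n = \sum_(i < n.+1) (p i ** q (n - i)%N).
Proof. by []. Qed.

Lemma apoly_mulEr p q n : apoly_mul p q n = \sum_(i < n.+1) (p (n - i)%N ** q i).
Proof.
rewrite apoly_mulE (reindex_inj rev_ord_inj) /=.
by apply: eq_bigr => i _; rewrite (sub_ordK i).
Qed.

Lemma apoly_mulA : associative apoly_mul.
Proof.
move=> p1 p2 p3; apply: finsupp_ext => i; rewrite apoly_mulE apoly_mulEr.
pose coef3 j k := p1 j ** (p2 (i - j - k)%N ** p3 k).
transitivity (\sum_(j < i.+1) \sum_(k < i.+1 | (k <= i - j)%N) coef3 j k).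
  apply: eq_bigr => j _; rewrite apoly_mulEr amul_sumr.
  by rewrite (big_ord_narrow_leq (leq_subr _ _)).
rewrite (exchange_big_dep predT) //=; apply: eq_bigr => k _.
transitivity (\sum_(j < i.+1 | (j <= i - k)%N) coef3 j k).
  apply: eq_bigl => j; rewrite -ltnS -(ltnS j) -!subSn ?leq_ord //.
  by rewrite -subn_gt0 -(subn_gt0 j) -!subnDA addnC.
rewrite (big_ord_narrow_leq (leq_subr _ _)) /apoly_mul_fun amul_suml /=.
by apply: eq_bigr => j _; rewrite /coef3 -!subnDA addnC amulA.
Qed.

Lemma apoly_mulDl : left_distributive apoly_mul +%R.
Proof.
move=> p q r; apply: finsupp_ext => n; rewrite finsuppD !apoly_mulE -big_split.
by apply: eq_bigr => i _; rewrite finsuppD amulDl.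
Qed.

Lemma apoly_mulDr : right_distributive apoly_mul +%R.
Proof.
move=> p q r; apply: finsupp_ext => n; rewrite finsuppD !apoly_mulE -big_split.
by apply: eq_bigr => i _; rewrite finsuppD amulDr.
Qed.

Lemma apoly_mulZl (k : l) p q : apoly_mul (k *: p) q = k *: apoly_mul p q.
Proof.
apply: finsupp_ext => n; rewrite finsuppZ !apoly_mulE scaler_sumr.
by apply: eq_bigr => i _; rewrite finsuppZ amulZl.
Qed.

Lemma apoly_mulZr (k : l) p q : apoly_mul p (k *: q) = k *: apoly_mul p q.
Proof.
apply: finsupp_ext => n; rewrite finsuppZ !apoly_mulE scaler_sumr.
by apply: eq_bigr => i _; rewrite finsuppZ amulZr.
Qed.

Definition poly_alg : algebra l := @Algebra l apoly apoly_mul apoly_mulA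
  apoly_mulDl apoly_mulDr apoly_mulZl apoly_mulZr.

Definition const_poly (a : A) : poly_alg := finsupp_single 0%N a.

Lemma const_poly_linear : linear const_poly.
Proof.
move=> k a b; apply: finsupp_ext => n.
rewrite finsuppD finsuppZ !finsupp_singleE; case: ifP => // _.
by rewrite scaler0 addr0.
Qed.

Lemma const_polyM a b : const_poly (a ** b) = const_poly a ** const_poly b.
Proof.
apply: finsupp_ext => n; rewrite [RHS]apoly_mulE big_ord_recl /= subn0.
rewrite big1 ?addr0 => [|i _]; last by rewrite /finsupp_single_fun amul0l.
by rewrite /finsupp_single_fun /=; case: (n == 0%N) => //; rewrite amul0r.
Qed.

Definition const_incl : alg_hom A poly_alg := AlgHom const_poly_linear const_polyM.
End Polynomials.

Record category := Category {
  ob :> Type;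
  hom : ob -> ob -> Type;
  idm : forall a, hom a a;
  comp : forall a b c, hom b c -> hom a b -> hom a c;
  comp1m : forall a b (f : hom a b), comp (idm b) f = f;
  compm1 : forall a b (f : hom a b), comp f (idm a) = f;
  compA : forall a b c d (h : hom c d) (g : hom b c) (f : hom a b),
    comp h (comp g f) = comp (comp h g) f }.
Arguments idm {_} _.

Declare Scope cat_scope.
Delimit Scope cat_scope with cat.
Notation "g \o f" := (comp g f) : cat_scope.

Record functor (C D : category) := Functor {
  fob :> C -> D;
  fmap : forall a b : C, hom a b -> hom (fob a) (fob b);
  fmap1 : forall a : C, fmap (idm a) = idm (fob a);
  fmap_comp : forall (a b c : C) (g : hom b c) (f : hom a b),
    fmap (g \o f)%cat = (fmap g \o fmap f)%cat }.
Arguments fmap {_ _} _ {_ _}.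

Definition is_iso (C : category) (a b : C) (f : hom a b) : Prop :=
  exists g : hom b a, (g \o f)%cat = idm a /\ (f \o g)%cat = idm b.

Definition isomorphic (C : category) (a b : C) : Prop :=
  exists f : hom a b, is_iso f.

Definition inverts (C D : category) (X : functor C D) (a b : C) (f : hom a b) : Prop :=
  is_iso (fmap X f).

(* Equality of morphisms whose sources and targets are not syntactically the same.
   It implies equality of the sources and of the targets, so that two functors are
   equal if and only if they have equal values, in this sense, on all morphisms. *)
Inductive arrow_eq (C : category) (a b : C) (f : hom a b) :
    forall c d : C, hom c d -> Prop :=
  ArrowEq : arrow_eq f f.

Record addcat := AddCat {
  aob :> Type;
  ahom : aob -> aob -> zmodType;
  aidm : forall a, ahom a a;
  acomp : forall a b c, ahom b c -> ahom a b -> ahom a c;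
  acomp1m : forall a b (f : ahom a b), acomp (aidm b) f = f;
  acompm1 : forall a b (f : ahom a b), acomp f (aidm a) = f;
  acompA : forall a b c d (h : ahom c d) (g : ahom b c) (f : ahom a b),
    acomp h (acomp g f) = acomp (acomp h g) f;
  acompDl : forall a b c (g g' : ahom b c) (f : ahom a b),
    acomp (g + g') f = acomp g f + acomp g' f;
  acompDr : forall a b c (g : ahom b c) (f f' : ahom a b),
    acomp g (f + f') = acomp g f + acomp g f';
  azero : exists z, aidm z = 0;
  abiprod : forall a b, exists c (i : ahom a c) (j : ahom b c) (p : ahom c a) (q : ahom c b),
    [/\ acomp p i = aidm a, acomp q j = aidm b &
        acomp i p + acomp j q = aidm c] }.

Definition addcat_category (T : addcat) : category :=
  @Category T (fun a b => ahom a b) (@aidm T) (@acomp T)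
    (@acomp1m T) (@acompm1 T) (@acompA T).
Coercion addcat_category : addcat >-> category.
Canonical addcat_category.

Definition additive_functor (T T' : addcat) (F : functor T T') : Prop :=
  forall (a b : T) (f g : ahom a b), fmap F (f + g : ahom a b) = fmap F f + fmap F g :> ahom (F a) (F b).

Definition is_equivalence (C D : category) (F : functor C D) : Prop :=
  (forall (a b : C) (h : hom (F a) (F b)), exists! f : hom a b, fmap F f = h) /\
  (forall d : D, exists c : C, isomorphic (F c) d).

(* Verdier's axioms (octahedral axiom included) in terms of the desuspension Omega: a
   triangle Omega c -u-> a -v-> b -w-> c stands for a -v-> b -w-> c -h-> Sigma a where
   u is the desuspension of h. Omega is only required to be an equivalence, not an
   automorphism. *)
Section Triangles.
Variables (T : addcat) (Om : functor T T).
Local Open Scope cat_scope.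

Definition triangle_class :=
  forall (a b c : T), hom (Om c) a -> hom a b -> hom b c -> Prop.

Variable dist : triangle_class.

Definition dist_iso_closed : Prop :=
  forall (a b c a' b' c' : T)
    (u : hom (Om c) a) (v : hom a b) (w : hom b c)
    (u' : hom (Om c') a') (v' : hom a' b') (w' : hom b' c')
    (f : hom a a') (g : hom b b') (h : hom c c'),
  is_iso f -> is_iso g -> is_iso h ->
  f \o u = u' \o fmap Om h -> g \o v = v' \o f -> h \o w = w' \o g ->
  dist u v w -> dist u' v' w'.

(* For z a zero object the maps u and w are necessarily 0. *)
Definition dist_id : Prop :=
  forall (a z : T) (u : hom (Om z) a) (w : hom a z),
  aidm z = 0 -> dist u (idm a) w.

Definition dist_cone : Prop :=
  forall (a b : T) (v : hom a b),
  exists c (u : hom (Om c) a) (w : hom b c), dist u v w.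

Definition dist_rot : Prop :=
  forall (a b c : T) (u : hom (Om c) a) (v : hom a b) (w : hom b c),
  dist u v w <-> dist (- (fmap Om w : ahom (Om b) (Om c))) u v.

Definition dist_fill : Prop :=
  forall (a b c a' b' c' : T)
    (u : hom (Om c) a) (v : hom a b) (w : hom b c)
    (u' : hom (Om c') a') (v' : hom a' b') (w' : hom b' c')
    (f : hom a a') (g : hom b b'),
  dist u v w -> dist u' v' w' -> g \o v = v' \o f ->
  exists h : hom c c', f \o u = u' \o fmap Om h /\ h \o w = w' \o g.

Definition dist_octahedron : Prop :=
  forall (a b c c' b' a' : T) (f : hom a b) (g : hom b c)
    (u1 : hom (Om c') a) (p1 : hom b c')
    (u2 : hom (Om b') a) (p2 : hom c b')
    (u3 : hom (Om a') b) (p3 : hom c a'),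
  dist u1 f p1 -> dist u2 (g \o f) p2 -> dist u3 g p3 ->
  exists (x : hom c' b') (y : hom b' a'),
    [/\ dist (p1 \o u3) x y,
        x \o p1 = p2 \o g /\ u2 \o fmap Om x = u1 &
        y \o p2 = p3 /\ u3 \o fmap Om y = f \o u2].
End Triangles.

Record tricat := TriCat {
  tri_add :> addcat;
  omega : functor tri_add tri_add;
  omega_additive : additive_functor omega;
  omega_equiv : is_equivalence omega;
  dist : triangle_class omega;
  tri_iso : dist_iso_closed dist;
  tri_id : dist_id dist;
  tri_cone : dist_cone dist;
  tri_rot : dist_rot dist;
  tri_fill : dist_fill dist;
  tri_octahedron : dist_octahedron dist }.
Arguments omega {_}.
Arguments dist {_} {_ _ _}.

Record tri_functor (T T' : tricat) := TriFunctor {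
  tri_fun :> functor T T';
  tri_fun_additive : additive_functor tri_fun;
  tri_omega : forall a : T, hom (omega (tri_fun a)) (tri_fun (omega a));
  tri_omega_iso : forall a : T, is_iso (tri_omega a);
  tri_omega_nat : forall (a b : T) (f : hom a b),
    (tri_omega b \o fmap omega (fmap tri_fun f) =
     fmap tri_fun (fmap omega f) \o tri_omega a)%cat;
  tri_fun_dist : forall (a b c : T) (u : hom (omega c) a) (v : hom a b) (w : hom b c),
    dist u v w ->
    dist (fmap tri_fun u \o tri_omega c)%cat (fmap tri_fun v) (fmap tri_fun w) }.

Definition tri_functor_eq (T T' : tricat) (F F' : tri_functor T T') : Prop :=
  (forall (a b : T) (f : hom a b), arrow_eq (fmap F f) (fmap F' f)) /\
  (forall a : T, arrow_eq (tri_omega F a) (tri_omega F' a)).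

Record excat := ExCat {
  excat_cat :> category;
  extension : forall A B C : excat_cat, hom A B -> hom B C -> Prop }.

Record excisive (C : excat) (T : tricat) (X : functor C T) := Excisive {
  bd : forall (a b c : C) (f : hom a b) (g : hom b c),
    extension f g -> hom (omega (X c)) (X a);
  bd_nat : forall (a b c a' b' c' : C) (f : hom a b) (g : hom b c)
      (f' : hom a' b') (g' : hom b' c') (e : extension f g) (e' : extension f' g')
      (x : hom a a') (y : hom b b') (z : hom c c'),
    (y \o f)%cat = (f' \o x)%cat -> (z \o g)%cat = (g' \o y)%cat ->
    (fmap X x \o bd e)%cat = (bd e' \o fmap omega (fmap X z))%cat;
  bd_dist : forall (a b c : C) (f : hom a b) (g : hom b c) (e : extension f g),
    dist (bd e) (fmap X f) (fmap X g) }.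
Arguments bd {_ _ _} _ {_ _ _ _ _}.

(* F o X = X' strictly, and F maps the boundary maps of X to those of X' modulo the
   isomorphism tri_omega F. *)
Definition factors (C : excat) (T T' : tricat) (X : functor C T) (dX : excisive X)
    (X' : functor C T') (dX' : excisive X') (F : tri_functor T T') : Prop :=
  (forall (a b : C) (f : hom a b), arrow_eq (fmap F (fmap X f)) (fmap X' f)) /\
  (forall (a b c : C) (f : hom a b) (g : hom b c) (e : extension f g),
    arrow_eq (fmap F (bd dX e) \o tri_omega F (X c))%cat (bd dX' e)).

Definition initial_excisive (C : excat) (P : forall T : tricat, functor C T -> Prop)
    (T : tricat) (X : functor C T) (dX : excisive X) : Prop :=
  P T X /\
  forall (T' : tricat) (X' : functor C T') (dX' : excisive X'), P T' X' ->
    exists F : tri_functor T T', factors dX dX' F /\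
      forall F' : tri_functor T T', factors dX dX' F' -> tri_functor_eq F F'.

Record bimodule (l : comPzRingType) (A B : algebra l) := Bimodule {
  bm_mod :> lmodType l;
  lact : A -> bm_mod -> bm_mod;
  ract : bm_mod -> B -> bm_mod;
  lact_linl : forall p, linear (lact ^~ p);
  lact_linr : forall a, linear (lact a);
  ract_linl : forall b, linear (ract ^~ b);
  ract_linr : forall p, linear (ract p);
  lactM : forall a a' p, lact (a ** a') p = lact a (lact a' p);
  ractM : forall p b b', ract p (b ** b') = ract (ract p b) b';
  lract : forall a p b, ract (lact a p) b = lact a (ract p b) }.

Definition unitary (l : comPzRingType) (A B : algebra l) (eA : A) (eB : B)
    (P : bimodule A B) : Prop :=
  forall p : P, lact eA p = p /\ ract p eB = p.

Lemma linear_scale (l : pzRingType) (U V : lmodType l) (f : U -> V) :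
  linear f -> forall k u, f (k *: u) = k *: f u.
Proof.
move=> lf; have f0 : f 0 = 0.
  by have := lf (-1) 0 0; rewrite !scaleN1r !addNr.
by move=> k u; have := lf k u 0; rewrite f0 !addr0.
Qed.

Section Tensor.
Variables (l : comPzRingType) (A B C : algebra l).
Variables (P : bimodule A B) (Q : bimodule B C).

(* P (x)_B Q is the set of formal sums of pairs (p, q), written as sequences, modulo
   the congruence generated by the usual relations. As formal sums have no signs,
   0 (x) q = 0 has to be one of the relations. *)
Inductive tensor_cong : seq (P * Q) -> seq (P * Q) -> Prop :=
| tc_refl s : tensor_cong s s
| tc_sym s t : tensor_cong s t -> tensor_cong t s
| tc_trans s t u : tensor_cong s t -> tensor_cong t u -> tensor_cong s u
| tc_cat s s' t t' :
    tensor_cong s s' -> tensor_cong t t' -> tensor_cong (s ++ t) (s' ++ t')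
| tc_comm s t : tensor_cong (s ++ t) (t ++ s)
| tc_zero q : tensor_cong [:: (0, q)] [::]
| tc_addl p p' q : tensor_cong [:: (p + p', q)] [:: (p, q); (p', q)]
| tc_addr p q q' : tensor_cong [:: (p, q + q')] [:: (p, q); (p, q')]
| tc_scale k p q : tensor_cong [:: (k *: p, q)] [:: (p, k *: q)]
| tc_bal p b q : tensor_cong [:: (ract p b, q)] [:: (p, lact b q)].

Definition tensor_rel (s t : seq (P * Q)) : bool := `[< tensor_cong s t >].

Lemma tensor_rel_refl : reflexive tensor_rel.
Proof. by move=> s; apply/asboolP/tc_refl. Qed.
Lemma tensor_rel_sym : symmetric tensor_rel.
Proof. by move=> s t; apply/asboolP/asboolP => /tc_sym. Qed.
Lemma tensor_rel_trans : transitive tensor_rel.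
Proof. by move=> t s u /asboolP st /asboolP tu; apply/asboolP/(tc_trans st). Qed.

Canonical tensor_equiv :=
  EquivRel tensor_rel tensor_rel_refl tensor_rel_sym tensor_rel_trans.

Definition tensor := {eq_quot tensor_equiv}.
HB.instance Definition _ := Choice.on tensor.
HB.instance Definition _ := Quotient.on tensor.

Lemma tensor_eqP s t : tensor_cong s t <-> \pi_tensor s = \pi_tensor t.
Proof.
split; first by move=> h; apply/eqmodP/asboolP.
by move/eqmodP/asboolP.
Qed.

Lemma tensor_reprP s : tensor_cong (repr (\pi_tensor s)) s.
Proof. by apply/tensor_eqP; rewrite reprK. Qed.

Lemma tensor_ind (K : tensor -> Prop) : (forall s, K (\pi_tensor s)) -> forall x, K x.
Proof. by move=> h x; rewrite -[x]reprK. Qed.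

Definition tensor_scale_seq (k : l) (s : seq (P * Q)) : seq (P * Q) :=
  [seq (k *: x.1, x.2) | x <- s].

Lemma tensor_scale_cong k s t : tensor_cong s t ->
  tensor_cong (tensor_scale_seq k s) (tensor_scale_seq k t).
Proof.
elim => {s t}.
- by move=> s; apply: tc_refl.
- by move=> s t _; apply: tc_sym.
- by move=> s t u _ h _; apply: tc_trans.
- move=> s s' t t' _ h _ h'; rewrite /tensor_scale_seq !map_cat.
  exact: tc_cat.
- by move=> s t; rewrite /tensor_scale_seq !map_cat; apply: tc_comm.
- by move=> q /=; rewrite scaler0; apply: tc_zero.
- by move=> p p' q /=; rewrite scalerDr; apply: tc_addl.
- by move=> p q q' /=; apply: tc_addr.
- move=> k' p q /=; rewrite scalerA mulrC -scalerA; apply: tc_scale.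
- move=> p b q /=.
  have -> : k *: ract p b = ract (k *: p) b.
    by rewrite (linear_scale (ract_linl b)).
  exact: tc_bal.
Qed.

Definition tensor_zero : tensor := \pi_tensor [::].
Definition tensor_add (x y : tensor) : tensor := \pi_tensor (repr x ++ repr y).
Definition tensor_scale (k : l) (x : tensor) : tensor :=
  \pi_tensor (tensor_scale_seq k (repr x)).

Lemma tensor_addE s t :
  tensor_add (\pi_tensor s) (\pi_tensor t) = \pi_tensor (s ++ t).
Proof. by apply/tensor_eqP/tc_cat; apply: tensor_reprP. Qed.

Lemma tensor_scaleE k s :
  tensor_scale k (\pi_tensor s) = \pi_tensor (tensor_scale_seq k s).
Proof. by apply/tensor_eqP/tensor_scale_cong/tensor_reprP. Qed.

Lemma tensor_addA : associative tensor_add.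
Proof.
elim/tensor_ind => s; elim/tensor_ind => t; elim/tensor_ind => u.
by rewrite !tensor_addE catA.
Qed.

Lemma tensor_addC : commutative tensor_add.
Proof.
elim/tensor_ind => s; elim/tensor_ind => t.
by rewrite !tensor_addE; apply/tensor_eqP/tc_comm.
Qed.

Lemma tensor_add0 : left_id tensor_zero tensor_add.
Proof. by elim/tensor_ind => s; rewrite tensor_addE. Qed.

Lemma tensor_scaleDl_seq k k' s :
  tensor_cong (tensor_scale_seq (k + k') s)
              (tensor_scale_seq k s ++ tensor_scale_seq k' s).
Proof.
elim: s => [|[p q] s ih] /=; first exact: tc_refl.
rewrite scalerDl -cat1s.
apply: tc_trans (tc_cat (tc_addl _ _ _) ih) _.
rewrite -[X in tensor_cong _ X]cat1s -[_ :: tensor_scale_seq k' s]cat1s.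
rewrite -[[:: _; _]]/([:: (k *: p, q)] ++ [:: (k' *: p, q)]) -catA.
apply: tc_cat; first exact: tc_refl.
rewrite !catA; apply: tc_cat; last exact: tc_refl.
exact: tc_comm.
Qed.

Lemma tensor_scale0_seq s : tensor_cong (tensor_scale_seq 0 s) [::].
Proof.
elim: s => [|[p q] s ih] /=; first exact: tc_refl.
by rewrite scale0r -cat1s -[[::]]cat0s; apply: tc_cat => //; apply: tc_zero.
Qed.

Definition tensor_opp := tensor_scale (-1).

Lemma tensor_scaleDl x : {morph tensor_scale^~ x : k k' / k + k' >-> tensor_add k k'}.
Proof.
move: x; elim/tensor_ind => s k k'.
by rewrite !tensor_scaleE tensor_addE; apply/tensor_eqP/tensor_scaleDl_seq.
Qed.

Lemma tensor_scale1 : left_id 1 tensor_scale.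
Proof.
elim/tensor_ind => s; rewrite tensor_scaleE; congr (\pi_tensor _).
by rewrite -[RHS]map_id; apply: eq_map => -[p q] /=; rewrite scale1r.
Qed.

Lemma tensor_addN : left_inverse tensor_zero tensor_opp tensor_add.
Proof.
move=> x; rewrite -{2}[x]tensor_scale1 -tensor_scaleDl addNr.
move: x; elim/tensor_ind => s; rewrite tensor_scaleE.
exact/tensor_eqP/tensor_scale0_seq.
Qed.

HB.instance Definition _ := GRing.isZmodule.Build tensor
  tensor_addA tensor_addC tensor_add0 tensor_addN.

Lemma tensor_scaleA k k' x : tensor_scale k (tensor_scale k' x) = tensor_scale (k * k') x.
Proof.
move: x; elim/tensor_ind => s; rewrite !tensor_scaleE; congr (\pi_tensor _).
by rewrite /tensor_scale_seq -map_comp; apply: eq_map => -[p q] /=; rewrite scalerA.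
Qed.

Lemma tensor_scaleDr : right_distributive tensor_scale +%R.
Proof.
move=> k; elim/tensor_ind => s; elim/tensor_ind => t.
rewrite [X in tensor_scale k X]tensor_addE !tensor_scaleE [RHS]tensor_addE.
by rewrite /tensor_scale_seq map_cat.
Qed.

HB.instance Definition _ := GRing.Zmodule_isLmodule.Build l tensor
  tensor_scaleA tensor_scale1 tensor_scaleDr tensor_scaleDl.

Definition tens (p : P) (q : Q) : tensor := \pi_tensor [:: (p, q)].

End Tensor.

Lemma tensor_span (l : comPzRingType) (A B C : algebra l) (P : bimodule A B)
    (Q : bimodule B C) (x : tensor P Q) :
  exists s : seq (P * Q), x = \sum_(pq <- s) tens pq.1 pq.2.
Proof.
elim/tensor_ind: x => s; exists s.
elim: s => [|[p q] s ih]; first by rewrite big_nil.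
by rewrite big_cons -ih [RHS]tensor_addE.
Qed.

Section TensTheory.
Variables (l : comPzRingType) (A B C : algebra l).
Variables (P : bimodule A B) (Q : bimodule B C).
Implicit Types (p : P) (q : Q).

Lemma tensDl p p' q : tens (p + p') q = tens p q + tens p' q.
Proof. by rewrite [RHS]tensor_addE; apply/tensor_eqP/tc_addl. Qed.
Lemma tensDr p q q' : tens p (q + q') = tens p q + tens p q'.
Proof. by rewrite [RHS]tensor_addE; apply/tensor_eqP/tc_addr. Qed.
Lemma tensZl k p q : tens (k *: p) q = k *: tens p q.
Proof. by rewrite [RHS]tensor_scaleE. Qed.
Lemma tensZr k p q : tens p (k *: q) = k *: tens p q.
Proof. by rewrite -tensZl; apply/esym/tensor_eqP/tc_scale. Qed.
Lemma tens_bal p b q : tens (ract p b) q = tens p (lact b q).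
Proof. exact/tensor_eqP/tc_bal. Qed.
End TensTheory.

Record is_gmodule (G : groupType) (l : pzRingType) (V : lmodType l)
    (act : G -> V -> V) : Prop := IsGModule {
  gmod1 : forall v, act 1%g v = v;
  gmodM : forall g h v, act (g * h)%g v = act g (act h v);
  gmod_linear : forall g, linear (act g) }.

Record galgebra (l : comPzRingType) (G : groupType) := GAlgebra {
  galg_alg :> algebra l;
  gact : G -> galg_alg -> galg_alg;
  gact_gmodule : is_gmodule gact;
  gact_mul : forall g a b, gact g (a ** b) = gact g a ** gact g b }.

Record unital_galgebra (l : comPzRingType) (G : groupType) := UnitalGAlgebra {
  ugalg :> galgebra l G;
  gone : ugalg;
  gone_unit : is_unit gone;
  gact_one : forall g, gact g gone = gone }.

Record ghom (l : comPzRingType) (G : groupType) (A B : galgebra l G) := GHom {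
  ghom_fun :> alg_hom A B;
  ghom_equivariant : forall g a, ghom_fun (gact g a) = gact g (ghom_fun a) }.

Record gset (G : groupType) := GSet {
  gset_car :> choiceType;
  sact : G -> gset_car -> gset_car;
  sact1 : forall s, sact 1%g s = s;
  sactM : forall g h s, sact (g * h)%g s = sact g (sact h s) }.

Lemma sactK (G : groupType) (S : gset G) (g : G) : cancel (@sact G S g) (sact g^-1%g).
Proof. by move=> s; rewrite -sactM mulVg sact1. Qed.
Lemma sactKV (G : groupType) (S : gset G) (g : G) : cancel (@sact G S g^-1%g) (sact g).
Proof. by move=> s; rewrite -sactM mulgV sact1. Qed.

Definition trivial_gset (G : groupType) (S : choiceType) : gset G.
Proof. by exists S (fun _ => id). Defined.

Section GAlgCategory.
Variables (l : comPzRingType) (G : groupType).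
Implicit Types A B C : galgebra l G.

Lemma ghom_ext A B (f g : ghom A B) : (forall a, f a = g a) -> f = g.
Proof.
case: f g => [f fe] [g ge] /= /alg_hom_ext fg; subst g.
by congr GHom; apply: Prop_irrelevance.
Qed.

Definition ghom_id A : ghom A A.
Proof. by exists (alg_hom_id A). Defined.

Definition ghom_comp A B C (g : ghom B C) (f : ghom A B) : ghom A C.
Proof.
by exists (alg_hom_comp g f) => x a /=; rewrite !ghom_equivariant.
Defined.

Definition GAlg_category : category.
Proof.
refine (@Category (galgebra l G) (@ghom l G) ghom_id (@ghom_comp) _ _ _);
  by intros; apply: ghom_ext.
Defined.

Definition galg_extension A B C (f : ghom A B) (g : ghom B C) : Prop :=
  [/\ injective f, forall b, g b = 0 <-> exists a, f a = b, forall c, exists b, g b = c &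
      exists s : C -> B, [/\ linear s, forall x c, s (gact x c) = gact x (s c) &
                             forall c, g (s c) = c]].

Definition GAlg : excat :=
  @ExCat GAlg_category (fun A B C f g => galg_extension f g).
End GAlgCategory.

Section GConstructions.
Variables (l : comPzRingType) (G : groupType).

Lemma gact0 (A : galgebra l G) g : gact g 0 = 0 :> A.
Proof.
have := linear_scale (gmod_linear (gact_gmodule A) g) 0 0.
by rewrite !scale0r.
Qed.

Lemma gact_sum (A : galgebra l G) g (J : Type) (r : seq J) (F : J -> A) :
  gact g (\sum_(j <- r) F j) = \sum_(j <- r) gact g (F j).
Proof.
elim: r => [|j r ih]; first by rewrite !big_nil gact0.
rewrite !big_cons -ih -[F j]scale1r (gmod_linear (gact_gmodule A)).
by rewrite !scale1r.
Qed.

Section GMat.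
Variables (S : gset G) (A : galgebra l G).

(* Equivalently (mat_gact_unit), g.(E_{s,t} (x) a) = E_{g.s,g.t} (x) g.a. *)
Definition mat_gact_fun (g : G) (M : mat_alg S A) : S * S -> A :=
  fun p => gact g (M (sact g^-1%g p.1, sact g^-1%g p.2)).

Lemma mat_gact_subproof g M : mat_gact_fun g M \in finite_supp (S * S)%type A.
Proof.
have [r h] := finsupp_seq M; apply/finite_suppP.
exists [seq (sact g p.1, sact g p.2) | p <- r] => -[s t] nz; apply/mapP.
exists (sact g^-1%g s, sact g^-1%g t); last by rewrite /= !sactKV.
apply: h; apply: contraNneq nz => e; rewrite /mat_gact_fun e.
by rewrite gact0.
Qed.

Definition mat_gact g M : mat_alg S A := FinSupp (mat_gact_subproof g M).

Lemma mat_gactE g M s t :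
  mat_gact g M (s, t) = gact g (M (sact g^-1%g s, sact g^-1%g t)).
Proof. by []. Qed.

Lemma mat_gact_unit g s t a :
  mat_gact g (mat_unit s t a) = mat_unit (sact g s) (sact g t) (gact g a).
Proof.
apply: finsupp_ext => -[s' t']; rewrite mat_gactE !mat_unitE.
rewrite -(can_eq (@sactK _ S g)) sactKV -(can_eq (@sactK _ S g) _ t) sactKV.
by case: ifP => // _; rewrite gact0.
Qed.

Lemma mat_gact_gmodule : is_gmodule mat_gact.
Proof.
split.
- move=> M; apply: finsupp_ext => -[s t].
  by rewrite mat_gactE invg1 !sact1 (gmod1 (gact_gmodule A)).
- move=> g h M; apply: finsupp_ext => -[s t].
  by rewrite !mat_gactE invgM !sactM (gmodM (gact_gmodule A)).
- move=> g k M N; apply: finsupp_ext => -[s t].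
  by rewrite finsuppD finsuppZ !mat_gactE finsuppD finsuppZ
    (gmod_linear (gact_gmodule A)).
Qed.

Lemma mat_gact_mul g (M N : mat_alg S A) :
  mat_gact g (M ** N) = mat_gact g M ** mat_gact g N.
Proof.
apply: finsupp_ext => -[s t]; have [r [ur hM _]] := mat_mul_idx M [::].
have ugr : uniq [seq sact g u | u <- r].
  by rewrite map_inj_uniq //; apply: can_inj (@sactK _ S g).
rewrite mat_gactE [X in gact g X](mat_mulE ur) => [|u /hM [] //].
rewrite [RHS](mat_mulE ugr) => [|u nz _]; last first.
  rewrite -[u](@sactKV _ S g) map_f //.
  have [|_ //] := hM (sact g^-1%g s) (sact g^-1%g u).
  by apply: contraNneq nz => e; rewrite mat_gactE e gact0.
rewrite gact_sum big_map; apply: eq_bigr => u _.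
by rewrite !mat_gactE sactK gact_mul.
Qed.

Definition mat_galg : galgebra l G := @GAlgebra l G (mat_alg S A) mat_gact mat_gact_gmodule mat_gact_mul.
End GMat.

Section GMatMap.
Variables (S T : gset G) (A : galgebra l G) (f : S -> T).
Hypotheses (f_inj : injective f) (f_eq : forall g s, f (sact g s) = sact g (f s)).

Lemma mat_gmap_equivariant g (M : mat_galg S A) :
  mat_map A f_inj (gact g M) = gact g (mat_map A f_inj M : mat_galg T A).
Proof.
apply: finsupp_ext => -[s' t']; rewrite [RHS]mat_gactE.
case: (pselect (exists p, (f p.1, f p.2) = (s', t'))) => [[[s t] [<- <-]]|ne].
  by rewrite -!f_eq [LHS]mat_mapE [X in _ = gact g X]mat_mapE.
rewrite [LHS]mat_map_out => [|s t e]; last by apply: ne; exists (s, t).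
rewrite [X in _ = gact g X]mat_map_out ?gact0 // => s t [es et].
by apply: ne; exists (sact g s, sact g t); rewrite /= !f_eq es et !sactKV.
Qed.

Definition mat_gmap : ghom (mat_galg S A) (mat_galg T A) :=
  @GHom l G (mat_galg S A) (mat_galg T A) (mat_map A f_inj) mat_gmap_equivariant.
End GMatMap.

Definition matN_galg (A : galgebra l G) : galgebra l G := mat_galg (trivial_gset G nat) A.

Definition matN_gincl (A : galgebra l G) : ghom A (matN_galg A).
Proof.
exists (@mat_incl l nat A 1%N : alg_hom A (matN_galg A)) => g a.
by rewrite [RHS]mat_gact_unit.
Defined.

Section GPoly.
Variable A : galgebra l G.

Lemma poly_gact_subproof (g : G) (p : poly_alg A) :
  (fun n => gact g (p n)) \in finite_supp nat A.
Proof.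
have [r h] := finsupp_seq p; apply/finite_suppP; exists r => n nz.
by apply: h; apply: contraNneq nz => ->; rewrite gact0.
Qed.

Definition poly_gact g p : poly_alg A := FinSupp (poly_gact_subproof g p).

Lemma poly_gactE g p n : poly_gact g p n = gact g (p n). Proof. by []. Qed.

Lemma poly_gact_gmodule : is_gmodule poly_gact.
Proof.
split.
- by move=> p; apply: finsupp_ext => n; rewrite poly_gactE (gmod1 (gact_gmodule A)).
- move=> g h p; apply: finsupp_ext => n.
  by rewrite !poly_gactE (gmodM (gact_gmodule A)).
- move=> g k p q; apply: finsupp_ext => n.
  by rewrite finsuppD finsuppZ !poly_gactE (gmod_linear (gact_gmodule A)).
Qed.

Lemma poly_gact_mul g (p q : poly_alg A) :
  poly_gact g (p ** q) = poly_gact g p ** poly_gact g q.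
Proof.
apply: finsupp_ext => n; rewrite poly_gactE apoly_mulE [RHS]apoly_mulE gact_sum.
by apply: eq_bigr => i _; rewrite !poly_gactE gact_mul.
Qed.

Definition poly_galg : galgebra l G := @GAlgebra l G (poly_alg A) poly_gact poly_gact_gmodule poly_gact_mul.

Definition const_gincl : ghom A poly_galg.
Proof.
exists (const_incl A : alg_hom A poly_galg) => g a.
apply: finsupp_ext => n; rewrite [RHS]poly_gactE !finsupp_singleE.
by case: ifP => // _; rewrite gact0.
Defined.
End GPoly.
End GConstructions.

Section KKG.
Variables (l : comPzRingType) (G : groupType) (T : category).
Variable X : functor (GAlg l G) T.

Definition ghomotopy_invariant : Prop :=
  forall A : galgebra l G, inverts X (const_gincl A).

Definition gmatN_stable : Prop :=
  forall A : galgebra l G, inverts X (matN_gincl A).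

(* card [set: option G] is card G + 1. *)
Definition gstable : Prop :=
  forall (A : galgebra l G) (S S' : gset G) (f : S -> S') (f_inj : injective f)
    (f_eq : forall g s, f (sact g s) = sact g (f s)),
  [set: S] !=set0 -> ([set: S'] #<= [set: option G])%card ->
  inverts X (mat_gmap A f_inj f_eq).
End KKG.

(* The pair (kkG, jG) is given by its universal property. *)
Definition is_kkG (l : comPzRingType) (G : groupType) (kkG : tricat)
    (jG : functor (GAlg l G) kkG) (d : excisive jG) : Prop :=
  initial_excisive
    (fun T X => [/\ ghomotopy_invariant X, gmatN_stable X & gstable X]) d.

(* As pure tensors generate P (x) Q additively, it suffices to express bilinearity,
   equivariance and the associativity relations on them. *)
Record gmorita (l : comPzRingType) (G : groupType) (R S : unital_galgebra l G) :=
  GMorita {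
    gm_P : bimodule S R;
    gm_Q : bimodule R S;
    gm_P_unitary : unitary (gone S) (gone R) gm_P;
    gm_Q_unitary : unitary (gone R) (gone S) gm_Q;
    gm_Pact : G -> gm_P -> gm_P;
    gm_Qact : G -> gm_Q -> gm_Q;
    gm_P_gmodule : is_gmodule gm_Pact;
    gm_Q_gmodule : is_gmodule gm_Qact;
    gm_P_eq : forall g s p r,
      gm_Pact g (ract (lact s p) r) = ract (lact (gact g s) (gm_Pact g p)) (gact g r);
    gm_Q_eq : forall g r q s,
      gm_Qact g (ract (lact r q) s) = ract (lact (gact g r) (gm_Qact g q)) (gact g s);
    gm_alpha : {linear tensor gm_P gm_Q -> S};
    gm_beta : {linear tensor gm_Q gm_P -> R};
    gm_alpha_bij : bijective gm_alpha;
    gm_beta_bij : bijective gm_beta;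
    gm_alpha_bimod : forall s p q s',
      gm_alpha (tens (lact s p) (ract q s')) = s ** gm_alpha (tens p q) ** s';
    gm_beta_bimod : forall r q p r',
      gm_beta (tens (lact r q) (ract p r')) = r ** gm_beta (tens q p) ** r';
    gm_alpha_eq : forall g p q,
      gm_alpha (tens (gm_Pact g p) (gm_Qact g q)) = gact g (gm_alpha (tens p q));
    gm_beta_eq : forall g q p,
      gm_beta (tens (gm_Qact g q) (gm_Pact g p)) = gact g (gm_beta (tens q p));
    gm_assocP : forall p q p',
      lact (gm_alpha (tens p q)) p' = ract p (gm_beta (tens q p'));
    gm_assocQ : forall q p q',
      lact (gm_beta (tens q p)) q' = ract q (gm_alpha (tens p q')) }.

(* V is the internal direct sum of the submodules Vg g, g : G. *)
Record is_grading (G : groupType) (l : pzRingType) (V : lmodType l)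
    (Vg : G -> set V) : Prop := IsGrading {
  gr0 : forall g, Vg g 0;
  gr_linear : forall g (k : l) u v, Vg g u -> Vg g v -> Vg g (k *: u + v);
  gr_exists : forall v, exists f : finsupp G V,
    (forall g, Vg g (f g)) /\ v = \sum_(g \in [set: G]) f g;
  gr_unique : forall f : finsupp G V,
    (forall g, Vg g (f g)) -> \sum_(g \in [set: G]) f g = 0 -> forall g, f g = 0 }.

Record gralgebra (l : comPzRingType) (G : groupType) := GrAlgebra {
  gralg_alg :> algebra l;
  gr : G -> set gralg_alg;
  gr_grading : is_grading gr;
  gr_mul : forall g h a b, gr g a -> gr h b -> gr (g * h)%g (a ** b) }.

Record unital_gralgebra (l : comPzRingType) (G : groupType) := UnitalGrAlgebra {
  ugralg :> gralgebra l G;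
  grone : ugralg;
  grone_unit : is_unit grone;
  gr_one : gr 1%g grone }.

Record grhom (l : comPzRingType) (G : groupType) (A B : gralgebra l G) := GrHom {
  grhom_fun :> alg_hom A B;
  grhom_deg : forall g a, gr g a -> gr g (grhom_fun a) }.

Record grset (G : groupType) := GrSet {
  grset_car :> choiceType;
  sdeg : grset_car -> G }.

Definition trivial_grset (G : groupType) (S : choiceType) : grset G :=
  @GrSet G S (fun _ => 1%g).

Section GrAlgCategory.
Variables (l : comPzRingType) (G : groupType).
Implicit Types A B C : gralgebra l G.

Lemma grhom_ext A B (f g : grhom A B) : (forall a, f a = g a) -> f = g.
Proof.
case: f g => [f fe] [g ge] /= /alg_hom_ext fg; subst g.
by congr GrHom; apply: Prop_irrelevance.
Qed.

Definition grhom_id A : grhom A A.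
Proof. by exists (alg_hom_id A). Defined.

Definition grhom_comp A B C (g : grhom B C) (f : grhom A B) : grhom A C.
Proof.
by exists (alg_hom_comp g f) => x a /= ha; do 2!apply: grhom_deg.
Defined.

Definition GrAlg_category : category.
Proof.
refine (@Category (gralgebra l G) (@grhom l G) grhom_id (@grhom_comp) _ _ _);
  by intros; apply: grhom_ext.
Defined.

Definition gralg_extension A B C (f : grhom A B) (g : grhom B C) : Prop :=
  [/\ injective f, forall b, g b = 0 <-> exists a, f a = b, forall c, exists b, g b = c &
      exists s : C -> B, [/\ linear s, forall x c, gr x c -> gr x (s c) &
                             forall c, g (s c) = c]].

Definition GrAlg : excat :=
  @ExCat GrAlg_category (fun A B C f g => gralg_extension f g).
End GrAlgCategory.

Section GrFinsupp.
Variables (l : pzRingType) (G : groupType) (I : choiceType) (V : lmodType l).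
Variable Vg : G -> set V.
Hypothesis Vgr : is_grading Vg.
Variables (tau tau' : I -> G -> G).
Hypotheses (tauK : forall i, cancel (tau i) (tau' i))
  (tauK' : forall i, cancel (tau' i) (tau i)).

Definition finsupp_gr (g : G) : set (finsupp I V) :=
  [set f | forall i, Vg (tau i g) (f i)].

Lemma finsupp_sum (J : Type) (W : lmodType l) (K : choiceType) (r : seq J)
    (F : J -> finsupp K W) k :
  (\sum_(j <- r) F j) k = \sum_(j <- r) F j k.
Proof. by elim: r => [|j r ih]; rewrite ?big_nil // !big_cons finsuppD ih. Qed.

Lemma finsupp_fsum (W : lmodType l) (f : finsupp G W) : exists r : seq G,
  [/\ uniq r, forall g, f g != 0 -> g \in r &
      \sum_(g \in [set: G]) f g = \sum_(g <- r) f g].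
Proof.
have [r h] := finsupp_seq f; exists (undup r).
have h' g : f g != 0 -> g \in undup r by rewrite mem_undup; apply: h.
by split => //; [exact: undup_uniq|exact: fsum_seq (undup_uniq _) h'].
Qed.

Lemma finsupp_grading : is_grading finsupp_gr.
Proof.
split.
- by move=> g i; apply: gr0.
- by move=> g k u v hu hv i; apply: gr_linear.
- move=> v.
  have [F hF] := choice (gr_exists Vgr).
  have F0 g : F 0 g = 0.
    by have [h e] := hF 0; apply: (gr_unique Vgr h); rewrite -e.
  have [r hr] := finsupp_seq v.
  pose df (g : G) (i : I) : V := F (v i) (tau i g).
  have dfP g : df g \in finite_supp I V.
    apply/finite_suppP; exists r => i nz; apply: hr.
    by apply: contraNneq nz => e; rewrite /df e F0.
  pose d g : finsupp I V := FinSupp (dfP g).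
  have [q hq] : exists q : seq G, forall i g, df g i != 0 -> g \in q.
    have [sF hsF] := choice (fun u => finsupp_seq (F u)).
    exists (flatten [seq [seq tau' i h | h <- sF (v i)] | i <- r]) => i g nz.
    apply/flattenP; exists [seq tau' i h | h <- sF (v i)].
      apply/mapP; exists i => //; apply: hr.
      by apply: contraNneq nz => e; rewrite /df e F0.
    by rewrite -[g](tauK i) map_f //; apply: hsF.
  have dP : d \in finite_supp G (finsupp I V).
    apply/finite_suppP; exists q => g; apply: contraR => ng.
    apply/eqP/finsupp_ext => i; apply/eqP; apply: contraR ng; exact: hq.
  exists (FinSupp dP); split => [g i|]; first by have [h _] := hF (v i); apply: h.
  rewrite (fsum_seq (r := undup q)) ?undup_uniq // => [|g nz]; last first.
    rewrite mem_undup; apply: contraR nz => ng; apply/eqP/finsupp_ext => i.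
    by apply/eqP; apply: contraR ng; apply: hq.
  apply: finsupp_ext => i; rewrite finsupp_sum /=.
  have [_ ->] := hF (v i).
  rewrite (fsum_seq (r := [seq tau i g | g <- undup q])).
  + by rewrite big_map.
  + by rewrite map_inj_uniq ?undup_uniq //; apply: can_inj (tauK i).
  + move=> h nz; rewrite -[h](tauK' i) map_f // mem_undup; apply: (hq i).
    by rewrite /df tauK'.
- move=> f hf e g; apply: finsupp_ext => i.
  have [r [ur hr er]] := finsupp_fsum f.
  pose cf (h : G) : V := f (tau' i h) i.
  have cz h : cf h != 0 -> h \in [seq tau i x | x <- r].
    move=> nz; rewrite -[h](tauK' i) map_f //; apply: hr.
    by apply: contraNneq nz => e0; rewrite /cf e0.
  have cP : cf \in finite_supp G V by apply/finite_suppP; exists [seq tau i x | x <- r].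
  have := @gr_unique _ _ _ _ Vgr (FinSupp cP) _ _ (tau i g); rewrite /= /cf tauK; apply.
    by move=> h; have := hf (tau' i h) i; rewrite tauK'.
  rewrite (fsum_seq (r := [seq tau i x | x <- r])) //; last first.
    by rewrite map_inj_uniq //; apply: can_inj (tauK i).
  rewrite big_map; under eq_bigr do rewrite /= /cf tauK.
  by rewrite -finsupp_sum -er e.
Qed.
End GrFinsupp.

Section GrConstructions.
Variables (l : comPzRingType) (G : groupType).

Lemma gr_sum (A : gralgebra l G) g (J : Type) (r : seq J) (F : J -> A) :
  (forall j, gr g (F j)) -> gr g (\sum_(j <- r) F j).
Proof.
move=> h; elim: r => [|j r ih]; first by rewrite big_nil; apply: gr0 (gr_grading A) g.
by rewrite big_cons -[F j]scale1r; apply: gr_linear (gr_grading A) _ _ _ _ (h j) ih.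
Qed.

Section GrMat.
Variables (S : grset G) (A : gralgebra l G).

(* |E_{s,t} (x) a| = phi(s)|a|phi(t)^-1, so that M is homogeneous of degree g if and
   only if each M (s, t) is homogeneous of degree phi(s)^-1 g phi(t). *)
Definition mat_gr (g : G) : set (mat_alg S A) :=
  [set M | forall s t, gr ((sdeg s)^-1 * g * sdeg t)%g (M (s, t))].

Lemma mat_gr_unit s t g (a : A) : gr g a -> mat_gr (sdeg s * g * (sdeg t)^-1)%g (mat_unit s t a).
Proof.
move=> ha s' t'; rewrite mat_unitE; case: ifP => [/andP [/eqP -> /eqP ->]|_].
  by rewrite !mulgA mulVg mul1g mulgVK.
exact: gr0 (gr_grading A) _.
Qed.

Lemma mat_gr_grading : is_grading mat_gr.
Proof.
have := @finsupp_grading l G (S * S)%type A (@gr _ _ A) (gr_grading A)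
  (fun p g => ((sdeg p.1)^-1 * g * sdeg p.2)%g)
  (fun p g => (sdeg p.1 * g * (sdeg p.2)^-1)%g).
set Gr := finsupp_gr _ _; have -> : Gr = mat_gr.
  by apply/funext => g; apply/seteqP; split => [M h s t|M h [s t]];
    [exact: (h (s, t))|exact: h].
by apply=> -[s t] g /=; rewrite !mulgA ?(mulgV, mulVg) mul1g ?mulgK ?mulgVK.
Qed.

Lemma mat_gr_mul g h (M N : mat_alg S A) :
  mat_gr g M -> mat_gr h N -> mat_gr (g * h)%g (M ** N).
Proof.
move=> hM hN s t; have [r [ur hr _]] := mat_mul_idx M [::].
rewrite (mat_mulE ur) => [|u /hr [] //]; apply: gr_sum => u.
have := gr_mul (hM s u) (hN u t).
by rewrite !mulgA mulgK.
Qed.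

Definition mat_gralg : gralgebra l G := GrAlgebra mat_gr_grading mat_gr_mul.
End GrMat.

Section GrMatMap.
Variables (S T : grset G) (A : gralgebra l G) (f : S -> T).
Hypotheses (f_inj : injective f) (f_deg : forall s, sdeg (f s) = sdeg s).

Lemma mat_grmap_deg g (M : mat_gralg S A) :
  gr g M -> gr g (mat_map A f_inj M : mat_gralg T A).
Proof.
move=> hM s' t'.
case: (pselect (exists p, (f p.1, f p.2) = (s', t'))) => [[[s t] [<- <-]]|ne].
  by rewrite !f_deg mat_mapE; apply: hM.
rewrite [X in gr _ X]mat_map_out => [|s t e]; last by apply: ne; exists (s, t).
exact: gr0 (gr_grading A) _.
Qed.

Definition mat_grmap : grhom (mat_gralg S A) (mat_gralg T A) :=
  @GrHom l G (mat_gralg S A) (mat_gralg T A) (mat_map A f_inj) mat_grmap_deg.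
End GrMatMap.

Definition matN_gralg (A : gralgebra l G) : gralgebra l G :=
  mat_gralg (trivial_grset G nat) A.

Definition matN_grincl (A : gralgebra l G) : grhom A (matN_gralg A).
Proof.
exists (@mat_incl l nat A 1%N : alg_hom A (matN_gralg A)) => g a ha.
have := @mat_gr_unit (trivial_grset G nat) A 1%N 1%N g a ha.
by rewrite /= mul1g invg1 mulg1.
Defined.

Section GrPoly.
Variable A : gralgebra l G.

Definition poly_gr (g : G) : set (poly_alg A) := [set p | forall n, gr g (p n)].

Lemma poly_gr_grading : is_grading poly_gr.
Proof.
exact: (@finsupp_grading l G nat A (@gr _ _ A) (gr_grading A) (fun _ => id) (fun _ => id)).
Qed.

Lemma poly_gr_mul g h (p q : poly_alg A) :
  poly_gr g p -> poly_gr h q -> poly_gr (g * h)%g (p ** q).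
Proof. by move=> hp hq n; apply: gr_sum => i; apply: gr_mul. Qed.

Definition poly_gralg : gralgebra l G := GrAlgebra poly_gr_grading poly_gr_mul.

Definition const_grincl : grhom A poly_gralg.
Proof.
exists (const_incl A : alg_hom A poly_gralg) => g a ha n.
by rewrite finsupp_singleE; case: ifP => // _; apply: gr0 (gr_grading A) _.
Defined.
End GrPoly.
End GrConstructions.

Section KKGr.
Variables (l : comPzRingType) (G : groupType) (T : category).
Variable X : functor (GrAlg l G) T.

Definition grhomotopy_invariant : Prop :=
  forall A : gralgebra l G, inverts X (const_grincl A).

Definition grmatN_stable : Prop :=
  forall A : gralgebra l G, inverts X (matN_grincl A).

Definition grstable : Prop :=
  forall (A : gralgebra l G) (S S' : grset G) (f : S -> S') (f_inj : injective f)
    (f_deg : forall s, sdeg (f s) = sdeg s),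
  [set: S] !=set0 -> ([set: S'] #<= [set: G])%card ->
  inverts X (mat_grmap A f_inj f_deg).
End KKGr.

Definition is_kkGr (l : comPzRingType) (G : groupType) (kkGr : tricat)
    (jGr : functor (GrAlg l G) kkGr) (d : excisive jGr) : Prop :=
  initial_excisive
    (fun T X => [/\ grhomotopy_invariant X, grmatN_stable X & grstable X]) d.

Record grmorita (l : comPzRingType) (G : groupType) (R S : unital_gralgebra l G) :=
  GrMorita {
    grm_P : bimodule S R;
    grm_Q : bimodule R S;
    grm_P_unitary : unitary (grone S) (grone R) grm_P;
    grm_Q_unitary : unitary (grone R) (grone S) grm_Q;
    grm_Pgr : G -> set grm_P;
    grm_Qgr : G -> set grm_Q;
    grm_P_grading : is_grading grm_Pgr;
    grm_Q_grading : is_grading grm_Qgr;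
    grm_P_deg : forall g h k s p r, gr g s -> grm_Pgr h p -> gr k r ->
      grm_Pgr (g * h * k)%g (ract (lact s p) r);
    grm_Q_deg : forall g h k r q s, gr g r -> grm_Qgr h q -> gr k s ->
      grm_Qgr (g * h * k)%g (ract (lact r q) s);
    grm_alpha : {linear tensor grm_P grm_Q -> S};
    grm_beta : {linear tensor grm_Q grm_P -> R};
    grm_alpha_bij : bijective grm_alpha;
    grm_beta_bij : bijective grm_beta;
    grm_alpha_bimod : forall s p q s',
      grm_alpha (tens (lact s p) (ract q s')) = s ** grm_alpha (tens p q) ** s';
    grm_beta_bimod : forall r q p r',
      grm_beta (tens (lact r q) (ract p r')) = r ** grm_beta (tens q p) ** r';
    grm_alpha_deg : forall g h p q, grm_Pgr g p -> grm_Qgr h q ->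
      gr (g * h)%g (grm_alpha (tens p q));
    grm_beta_deg : forall g h q p, grm_Qgr g q -> grm_Pgr h p ->
      gr (g * h)%g (grm_beta (tens q p));
    grm_assocP : forall p q p',
      lact (grm_alpha (tens p q)) p' = ract p (grm_beta (tens q p'));
    grm_assocQ : forall q p q',
      lact (grm_beta (tens q p)) q' = ract q (grm_alpha (tens p q')) }.

(* Main.v *)
(* By M_N-stability all corner inclusions t |-> (n, t) of index sets T -> N x T give the
   same isomorphism, hence so do any two embeddings T -> T', and an embedding T -> T' is
   inverted as soon as T' embeds in N x T. If 1_S is the sum of alpha(p_i (x) q_i), then
   a |-> (beta(q_i (x) a p_j))_{i,j} is a homomorphism from S to matrices over R; it becomes
   equivariant after tensoring with M_G and replacing p_i, q_i by g.p_i, g.q_i, and it is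
   graded for suitable degrees of the indices when p_i, q_i are homogeneous. Composed with
   the analogous homomorphism from R back to matrices over S, it is x |-> (u_i x v_j)_{i,j}
   with the sum of the v_i u_i equal to 1. Such a map and a corner inclusion are the two
   restrictions of one homomorphism defined on M_2 M_G S, so the composite is inverted; by
   symmetry and two-out-of-six, so is each of the two maps. *)
From mathcomp Require Import all_boot all_algebra all_classical.
Require Import Defs.

Set Implicit Arguments.
Unset Strict Implicit.
Unset Printing Implicit Defensive.

Import GRing.Theory.
Local Open Scope ring_scope.

(** * Embeddings and countable copies *)

Section Isomorphisms.
Variable C : category.
Local Open Scope cat_scope.

Lemma is_iso_comp (a b c : C) (g : hom b c) (f : hom a b) :
  is_iso g -> is_iso f -> is_iso (g \o f).
Proof.
move=> [g' [gK gK']] [f' [fK fK']]; exists (f' \o g'); split.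
  by rewrite -compA (compA g') gK comp1m.
by rewrite -compA (compA f) fK' comp1m.
Qed.

Lemma iso_mono (a b c : C) (g : hom b c) (f f' : hom a b) :
  is_iso g -> g \o f = g \o f' -> f = f'.
Proof. by move=> [h [hg _]] e; rewrite -[f]comp1m -[f']comp1m -hg -!compA e. Qed.

Lemma iso_epi (a b c : C) (g g' : hom b c) (f : hom a b) :
  is_iso f -> g \o f = g' \o f -> g = g'.
Proof. by move=> [h [_ fh]] e; rewrite -[g]compm1 -[g']compm1 -fh !compA e. Qed.

Lemma is_iso_cancel_l (a b c : C) (g : hom b c) (f : hom a b) :
  is_iso g -> is_iso (g \o f) -> is_iso f.
Proof.
move=> ig [h [hK hK']]; exists (h \o g); rewrite -compA hK; split=> //.
by apply: (iso_mono ig); rewrite compm1 !compA hK' comp1m.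
Qed.

(* The two-out-of-six property. *)
Lemma is_iso_2of6 (a b c d : C) (f : hom a b) (g : hom b c) (h : hom c d) :
  is_iso (g \o f) -> is_iso (h \o g) -> is_iso f.
Proof.
move=> [x [xK xK']] [y [yK yK']].
apply: (@is_iso_cancel_l _ _ _ g); last by exists x.
exists (f \o x); split; last by rewrite compA xK'.
have -> : f \o x = y \o h.
  by rewrite -[f]comp1m -yK -!compA (compA g) xK' compm1.
by rewrite -compA yK.
Qed.

Lemma isomorphic_sym (a b : C) : isomorphic a b -> isomorphic b a.
Proof. by move=> [f [g [gf fg]]]; exists g, f. Qed.

Lemma isomorphic_trans (a b c : C) :
  isomorphic a b -> isomorphic b c -> isomorphic a c.
Proof. by move=> [f fi] [g gi]; exists (g \o f); apply: is_iso_comp. Qed.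
End Isomorphisms.

Lemma fmap_iso (C D : category) (X : functor C D) (a b : C) (f : hom a b) :
  is_iso f -> inverts X f.
Proof. by move=> [g [gf fg]]; exists (fmap X g); rewrite -!fmap_comp gf fg !fmap1. Qed.

Section CountableCopies.
Local Open Scope cat_scope.

(* In the applications [cp T] is N x T, [slice T n] is t |-> (n, t), and F is
   (n, t) |-> (h n, f n t). *)
Record copies (E : category) := Copies {
  cp : E -> E;
  slice : forall T, nat -> hom T (cp T);
  cp_map : forall T T' (h : nat -> nat) (f : nat -> hom T T'), injective h ->
    exists F : hom (cp T) (cp T'), forall n, F \o slice T n = slice T' (h n) \o f n }.
Arguments slice {E} _ _ _.

Variables (E D : category) (Y : functor E D) (N : copies E).
Hypothesis slice1 : forall T, inverts Y (slice N T 1).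

Local Notation s T n := (fmap Y (slice N T n)).

Lemma cp_reindex T (h : nat -> nat) : injective h ->
  exists F : hom (Y (cp N T)) (Y (cp N T)), forall n, F \o s T n = s T (h n).
Proof.
move=> hi; have [F FE] := cp_map N (fun _ => idm T) hi.
by exists (fmap Y F) => n; rewrite -fmap_comp FE compm1.
Qed.

Let swap (m n k : nat) := if k == m then n else if k == n then m else k.

Lemma swap_inj m n : injective (swap m n).
Proof.
apply: (can_inj (g := swap m n)) => k; rewrite /swap.
have [->|km] := eqVneq k m.
  by have [->|nm] := eqVneq n m; rewrite ?eqxx ?(negbTE nm).
have [->|kn] := eqVneq k n; first by rewrite eqxx.
by rewrite (negbTE km) (negbTE kn).
Qed.

(** The transposition of 1 and [n] induces a map that carries slice 1 to slice [n]. It is an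
    involution: this may be tested on slice 1, which [Y] inverts. Hence slice [n] is inverted as
    well. *)
Lemma slice_iso T n : inverts Y (slice N T n).
Proof.
have [F FE] := cp_reindex T (@swap_inj 1%N n).
have FF : F \o F = idm _.
  apply: (iso_epi (slice1 T)); rewrite comp1m -compA !FE /swap eqxx.
  by case: ifP => [/eqP ->|] //; rewrite eqxx.
have := FE 1%N; rewrite /swap eqxx /inverts => <-.
by apply: is_iso_comp (slice1 T); exists F.
Qed.

(* Swapping m and n fixes a third slice, hence acts as the identity. *)
Lemma slice_eq T m n : s T m = s T n.
Proof.
pose k := (m + n).+1.
have [F FE] := cp_reindex T (@swap_inj m n).
have F1 : F = idm _.
  apply: (iso_epi (slice_iso T k)); rewrite comp1m FE /swap.
  have /negbTE -> : k != m by rewrite gtn_eqF // ltnS leq_addr.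
  by have /negbTE -> : k != n by rewrite gtn_eqF // ltnS leq_addl.
by have := FE m; rewrite F1 comp1m /swap eqxx.
Qed.

(* f on copy 0 and f' on copy 1 are parts of a single map of copies. *)
Lemma embeddings_eq T T' (f f' : hom T T') : fmap Y f = fmap Y f'.
Proof.
have [F FE] := cp_map N (fun n => if n is 0%N then f else f') (@inj_id nat).
have e0 := FE 0%N; have e1 := FE 1%N.
apply: (iso_mono (slice_iso T' 0)); rewrite -fmap_comp -e0 fmap_comp.
by rewrite (slice_eq T 0 1) -fmap_comp e1 fmap_comp (slice_eq T' 1 0).
Qed.

(** Parallel embeddings agree under [Y], so [e] after [f] and [F] after [e] become slices, hence
    isomorphisms; two-out-of-six applies to [f], [e], [F]. *)
Lemma embedding_iso T T' (f : hom T T') (e : hom T' (cp N T)) : inverts Y f.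
Proof.
have [F _] := cp_map N (fun _ => f) (@inj_id nat).
apply: (@is_iso_2of6 _ _ _ _ _ _ (fmap Y e) (fmap Y F)); rewrite -fmap_comp.
  by rewrite (embeddings_eq _ (slice N T 1)); apply: slice1.
by rewrite (embeddings_eq _ (slice N T' 1)); apply: slice1.
Qed.
End CountableCopies.

Section Linear.
Variables (l : pzRingType) (U V : lmodType l) (f : U -> V).
Hypothesis lf : linear f.

Lemma linear_zero : f 0 = 0.
Proof. by rewrite -[0 in LHS](scale0r 0) (linear_scale lf) scale0r. Qed.

Lemma linear_plus u v : f (u + v) = f u + f v.
Proof. by have := lf 1 u v; rewrite !scale1r. Qed.

Lemma linear_big (J : Type) (r : seq J) (P : pred J) (F : J -> U) :
  f (\sum_(j <- r | P j) F j) = \sum_(j <- r | P j) f (F j).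
Proof.
by elim/big_rec2: _ => [|j x y _ <-]; rewrite ?linear_zero ?linear_plus.
Qed.
End Linear.

Lemma tens0l (l : comPzRingType) (A B C : algebra l) (P : bimodule A B) (Q : bimodule B C)
  (q : Q) : tens (0 : P) q = 0.
Proof. by rewrite -[X in tens X _](scale0r 0) tensZl scale0r. Qed.

(** * Homomorphisms between matrix algebras *)

Section Matrices.
Variable l : comPzRingType.
Implicit Types A B : algebra l.

Definition alg_hom_inv A B (f : alg_hom A B) (g : B -> A) :
  cancel f g -> cancel g f -> alg_hom B A.
Proof.
move=> fK gK; exists g => [k a b|a b]; apply: (can_inj fK).
  by rewrite (alg_hom_linear f) !gK.
by rewrite alg_homM !gK.
Defined.

Lemma mat_map_in (S T : choiceType) A (f : S -> T) (fi : injective f)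
    (M : mat_alg S A) s t : (mat_map A fi M : mat_alg T A) (f s, f t) = M (s, t).
Proof. exact: mat_mapE. Qed.

Lemma mat_map_notin (S T : choiceType) A (f : S -> T) (fi : injective f)
    (M : mat_alg S A) s' t' :
  (forall s, f s <> s') \/ (forall t, f t <> t') ->
  (mat_map A fi M : mat_alg T A) (s', t') = 0.
Proof.
by move=> h; apply: mat_map_out => s t [es et]; case: h => h; [apply: (h s)|apply: (h t)].
Qed.

Lemma mat_map_id (S : choiceType) A (i : injective (@idfun S)) M :
  mat_map A i M = M.
Proof. by apply: finsupp_ext => -[s t]; apply: (mat_map_in i). Qed.

(** With [mat_map_id], functoriality in the index set. Injectivity of the composite is an argument
    of its own, so that the proof carried by a composed embedding fits. *)
Lemma mat_map_comp (S T U : choiceType) A (f : S -> T) (g : T -> U)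
    (fi : injective f) (gi : injective g) (gfi : injective (fun s => g (f s))) M :
  mat_map A gfi M = mat_map A gi (mat_map A fi M).
Proof.
apply: finsupp_ext => -[s' t'].
have out (q : U) : (exists s, g (f s) = q) \/ (forall s, g (f s) <> q).
  by case: (pselect (exists s, g (f s) = q)) => h; [left|right=> s e; apply: h; exists s].
have out' (q : U) : (exists s, g s = q) \/ (forall s, g s <> q).
  by case: (pselect (exists s, g s = q)) => h; [left|right=> s e; apply: h; exists s].
case: (out' s') => [[s es]|h]; last first.
  rewrite [LHS]mat_map_notin ?[RHS]mat_map_notin //; left=> // s; exact: h.
case: (out' t') => [[t et]|h]; last first.
  rewrite [LHS]mat_map_notin ?[RHS]mat_map_notin //; right=> // t; exact: h.
rewrite -es -et [RHS]mat_map_in.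
case: (pselect (exists a, f a = s)) => [[a ea]|h]; last first.
  rewrite [LHS]mat_map_notin ?[RHS]mat_map_notin //; left=> a.
    by move=> e; apply: h; exists a.
  by move/gi => e; apply: h; exists a.
case: (pselect (exists b, f b = t)) => [[b eb]|h]; last first.
  rewrite [LHS]mat_map_notin ?[RHS]mat_map_notin //; right=> b.
    by move=> e; apply: h; exists b.
  by move/gi => e; apply: h; exists b.
by rewrite -ea -eb [RHS]mat_map_in; apply: (mat_map_in gfi).
Qed.

(** * Matrices of matrices *)

Section Curry.
Variables (I T : choiceType) (A : algebra l).
Implicit Types M : mat_alg (I * T)%type A.

Lemma curry_entry_subproof M i j :
  (fun p : T * T => M ((i, p.1), (j, p.2))) \in finite_supp (T * T)%type A.
Proof.
have [r h] := finsupp_seq M.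
apply/finite_suppP; exists [seq (x.1.2, x.2.2) | x <- r] => -[s t] /h sr.
by apply/mapP; exists ((i, s), (j, t)).
Qed.

Definition curry_entry M i j : mat_alg T A := FinSupp (curry_entry_subproof M i j).

Lemma curry_subproof M :
  (fun p : I * I => curry_entry M p.1 p.2) \in finite_supp (I * I)%type (mat_alg T A).
Proof.
have [r h] := finsupp_seq M.
apply/finite_suppP; exists [seq (x.1.1, x.2.1) | x <- r] => -[i j].
apply: contraR => nr; apply/eqP/finsupp_ext => -[s t] /=.
by apply/eqP; apply: contraR nr => /h sr; apply/mapP; exists ((i, s), (j, t)).
Qed.

Definition curry_fun M : mat_alg I (mat_alg T A) := FinSupp (curry_subproof M).

Lemma curry_linear : linear curry_fun.
Proof. by move=> k M N; apply: finsupp_ext => -[i j]; apply: finsupp_ext => -[s t]. Qed.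

Lemma curryM M N : curry_fun (M ** N) = curry_fun M ** curry_fun N.
Proof.
apply: finsupp_ext => -[i j]; apply: finsupp_ext => -[s t].
have [r [_ h _]] := mat_mul_idx M [::].
(* The product of [ri] and [rt] contains every summation index that matters, so the sum over pairs
   becomes a sum over blocks of sums inside a block. *)
pose ri := undup (unzip1 r); pose rt := undup (unzip2 r).
have hM x k u : M (x, (k, u)) != 0 -> k \in ri /\ u \in rt.
  by case/h=> _ kr; rewrite !mem_undup; split; apply/mapP; exists (k, u).
have ur : uniq [seq (k, u) | k <- ri, u <- rt].
  by apply: allpairs_uniq; rewrite ?undup_uniq // => -[? ?] [? ?].
rewrite [LHS](mat_mulE ur) => [|[k u] /hM [kr ut] _]; last exact: allpairs_f.
rewrite big_allpairs [X in _ = finsupp_fun X _](mat_mulE (r := ri)) ?undup_uniq //; last first.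
  move=> k nz _; apply: contraR nz => kr; apply/eqP/finsupp_ext => -[x y] /=.
  by apply/eqP; apply: contraR kr => /hM [].
rewrite finsupp_sum; apply: eq_bigr => k _.
by rewrite [RHS](mat_mulE (r := rt)) ?undup_uniq // => u /hM [].
Qed.

Definition curry : alg_hom (mat_alg (I * T)%type A) (mat_alg I (mat_alg T A)) :=
  AlgHom curry_linear curryM.

Lemma curryE M i j s t : (curry M : mat_alg I (mat_alg T A)) (i, j) (s, t) = M ((i, s), (j, t)).
Proof. by []. Qed.

Lemma uncurry_subproof (N : mat_alg I (mat_alg T A)) :
  (fun x : (I * T) * (I * T) => N (x.1.1, x.2.1) (x.1.2, x.2.2))
    \in finite_supp ((I * T) * (I * T))%type A.
Proof.
(* Finitely many blocks are nonzero ([r]), and each has finitely many nonzero entries ([q]). *)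
have [r h] := finsupp_seq N; have [q hq] := choice (fun ij => finsupp_seq (N ij)).
apply/finite_suppP.
exists (flatten [seq [seq ((ij.1, st.1), (ij.2, st.2)) | st <- q ij] | ij <- r]).
move=> [[i s] [j t]] /= nz.
apply/flattenP; exists [seq ((i, st.1), (j, st.2)) | st <- q (i, j)].
  by apply/mapP; exists (i, j) => //; apply: h; apply: contraNneq nz => ->.
by apply/mapP; exists (s, t) => //; apply: hq.
Qed.

Definition uncurry_fun N : mat_alg (I * T)%type A := FinSupp (uncurry_subproof N).

Lemma curryK : cancel curry uncurry_fun.
Proof. by move=> M; apply: finsupp_ext => -[[i s] [j t]]. Qed.

Lemma uncurryK : cancel uncurry_fun curry.
Proof.
by move=> N; apply: finsupp_ext => -[i j]; apply: finsupp_ext => -[s t].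
Qed.

Definition uncurry := alg_hom_inv curryK uncurryK.

(** Currying turns a slice inclusion into a corner inclusion, the kind of map that M_N-stability
    inverts. *)
Lemma curry_map i (ii : injective (pair i : T -> I * T)) (N : mat_alg T A) :
  curry (mat_map A ii N) = mat_incl (mat_alg T A) i N.
Proof.
apply: finsupp_ext => -[j k]; apply: finsupp_ext => -[s t].
rewrite curryE [X in _ = finsupp_fun X _]mat_unitE.
have [->|ji] := eqVneq j i; last first.
  by rewrite [LHS]mat_map_notin //; left=> u [] /esym/eqP; rewrite (negbTE ji).
have [->|ki] := eqVneq k i; first by rewrite [LHS](mat_map_in ii).
by rewrite [LHS]mat_map_notin //; right=> u [] /esym/eqP; rewrite (negbTE ki).
Qed.
End Curry.

Section PointMatrices.
Variable A : algebra l.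

Definition point_entry (M : mat_alg unit A) : A := M (tt, tt).

Lemma point_inclK : cancel (mat_incl A tt) point_entry.
Proof. by []. Qed.

Lemma point_entryK : cancel point_entry (mat_incl A tt).
Proof. by move=> M; apply: finsupp_ext => -[[] []]. Qed.

Definition point_proj := alg_hom_inv point_inclK point_entryK.
End PointMatrices.

(** * Homomorphisms that spread matrix entries along a map of finite index sets *)

Section SpreadMatrices.
Variables (K : choiceType) (C C' : finType) (rho : C' -> C) (A B : algebra l).
Variable th : C' * K -> C' * K -> A -> B.
Hypothesis th_linear : forall u v, linear (th u v).
Hypothesis thM : forall u w c k x y,
  \sum_(c' | rho c' == c) (th u (c', k) x ** th (c', k) w y) = th u w (x ** y).

Let pi (u : C' * K) : C * K := (rho u.1, u.2).
Implicit Types M : mat_alg (C * K)%type A.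

(** [K] may be infinite, but the fibres of [rho] are finite, so finite support is kept. *)
Lemma spread_subproof M :
  (fun p => th p.1 p.2 (M (pi p.1, pi p.2))) \in finite_supp ((C' * K) * (C' * K))%type B.
Proof.
have [r h] := finsupp_seq M; apply/finite_suppP.
exists [seq ((a.1, x.1.2), (a.2, x.2.2)) | x <- r, a <- enum {: C' * C'}].
move=> [[a s] [b t]] /= nz; apply/allpairsP; exists ((pi (a, s), pi (b, t)), (a, b)).
split; rewrite ?mem_enum //=; apply: h.
by apply: contraNneq nz => e; rewrite e linear_zero.
Qed.

Definition spread_fun M : mat_alg (C' * K)%type B := FinSupp (spread_subproof M).

Lemma spread_linear : linear spread_fun.
Proof.
by move=> k M N; apply: finsupp_ext => -[u v]; apply: th_linear.
Qed.

(** The inner index is grouped by the fibres of [rho], and [thM] collapses each fibre to one term of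
    the original product. *)
Lemma spreadM M N : spread_fun (M ** N) = spread_fun M ** spread_fun N.
Proof.
apply: finsupp_ext => -[u w] /=.
have [r [_ h _]] := mat_mul_idx M [::]; pose rk := undup (unzip2 r).
have hM x c k : M (x, (c, k)) != 0 -> k \in rk.
  by case/h=> _ cr; rewrite mem_undup; apply/mapP; exists (c, k).
have uniq_prod (F : finType) : uniq [seq (c, k) | c <- enum F, k <- rk].
  by apply: allpairs_uniq; rewrite ?undup_uniq ?enum_uniq // => -[? ?] [? ?].
rewrite [X in th _ _ X](mat_mulE (uniq_prod C)) => [|[c k] /hM kr _]; last first.
  by apply: allpairs_f; rewrite ?mem_enum.
rewrite [RHS](mat_mulE (uniq_prod C')) => [|[c k] nz _]; last first.
  apply: allpairs_f; rewrite ?mem_enum //; apply: (@hM (pi u) (rho c)).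
  by apply: contraNneq nz => e; rewrite /= e linear_zero.
rewrite linear_big // !big_allpairs !big_enum /= exchange_big [RHS]exchange_big /=.
apply: eq_bigr => k _; rewrite [RHS](partition_big rho predT) //=.
apply: eq_bigr => c _; rewrite -(thM u w c k); apply: eq_bigr => c' /eqP e.
by rewrite /pi /= e.
Qed.

Definition spread : alg_hom (mat_alg (C * K)%type A) (mat_alg (C' * K)%type B) :=
  AlgHom spread_linear spreadM.
End SpreadMatrices.

Lemma sum_fiber_snd (I C : finType) (V : nmodType) (c : C) (F : I * C -> V) :
  \sum_(x : I * C | x.2 == c) F x = \sum_i F (i, c).
Proof.
rewrite (reindex_onto (fun i => (i, c)) fst) => [|[i c'] /eqP <- //].
by apply: eq_bigl => i; rewrite !eqxx.
Qed.

(** What equivariant and graded Morita equivalences share once the action or grading is forgotten,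
    with [A] in the role of [S] and [B] in that of [R]; both cases then use the same matrix
    homomorphisms. *)
Record morita_context A B := MoritaContext {
  mc_eA : A;
  mc_eB : B;
  mc_eA_unit : is_unit mc_eA;
  mc_eB_unit : is_unit mc_eB;
  mc_P : bimodule A B;
  mc_Q : bimodule B A;
  mc_P_unitary : unitary mc_eA mc_eB mc_P;
  mc_Q_unitary : unitary mc_eB mc_eA mc_Q;
  mc_alpha : {linear tensor mc_P mc_Q -> A};
  mc_beta : {linear tensor mc_Q mc_P -> B};
  mc_alpha_bimod : forall s p q s',
    mc_alpha (tens (lact s p) (ract q s')) = s ** mc_alpha (tens p q) ** s';
  mc_beta_bimod : forall r q p r',
    mc_beta (tens (lact r q) (ract p r')) = r ** mc_beta (tens q p) ** r';
  mc_assocP : forall p q p',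
    lact (mc_alpha (tens p q)) p' = ract p (mc_beta (tens q p'));
  mc_assocQ : forall q p q',
    lact (mc_beta (tens q p)) q' = ract q (mc_alpha (tens p q')) }.

Definition mc_swap A B (m : morita_context A B) : morita_context B A :=
  MoritaContext (mc_eB_unit m) (mc_eA_unit m) (@mc_Q_unitary A B m) (@mc_P_unitary A B m)
    (@mc_beta_bimod A B m) (@mc_alpha_bimod A B m) (@mc_assocQ A B m) (@mc_assocP A B m).

Section MoritaContextTheory.
Variables (A B : algebra l) (m : morita_context A B).
Implicit Types (p : mc_P m) (q : mc_Q m) (a : A) (b : B).

(** A unit inserted on the other side reduces the two-sided axiom to a one-sided rule. *)
Lemma mc_alphaZl a p q : mc_alpha m (tens (lact a p) q) = a ** mc_alpha m (tens p q).
Proof.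
have [_ qe] := mc_Q_unitary q.
by rewrite -{1}qe mc_alpha_bimod; have [_ ->] := mc_eA_unit m (a ** mc_alpha m (tens p q)).
Qed.

Lemma mc_alphaZr p q a : mc_alpha m (tens p (ract q a)) = mc_alpha m (tens p q) ** a.
Proof.
have [pe _] := mc_P_unitary p.
by rewrite -{1}pe mc_alpha_bimod; have [-> _] := mc_eA_unit m (mc_alpha m (tens p q)).
Qed.

Lemma mc_betaZl b q p : mc_beta m (tens (lact b q) p) = b ** mc_beta m (tens q p).
Proof.
have [_ pe] := mc_P_unitary p.
by rewrite -{1}pe mc_beta_bimod; have [_ ->] := mc_eB_unit m (b ** mc_beta m (tens q p)).
Qed.

Lemma mc_beta_linear q p : linear (fun a => mc_beta m (tens q (lact a p))).
Proof. by move=> k a a'; rewrite lact_linl tensDr tensZr linearP. Qed.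

(** Mixed associativity makes the inner vectors [p] and [q'] meet in [mc_alpha]; summed over a frame
    they give 1, which makes [mc_spread] multiplicative. *)
Lemma mc_betaM q p a q' p' a' :
  mc_beta m (tens q (lact a p)) ** mc_beta m (tens q' (lact a' p')) =
  mc_beta m (tens q (lact (a ** mc_alpha m (tens p q') ** a') p')).
Proof. by rewrite -mc_betaZl mc_assocQ tens_bal -lactM mc_alphaZl. Qed.

(** An entry of the composite there and back: [a] is multiplied on both sides by elements of [A], so
    the composite is a conjugation. *)
Lemma mc_alpha_beta p' q a p q' :
  mc_alpha m (tens p' (lact (mc_beta m (tens q (lact a p))) q')) =
  mc_alpha m (tens p' q) ** a ** mc_alpha m (tens p q').
Proof. by rewrite mc_assocQ mc_alphaZr mc_alphaZl amulA. Qed.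

Variables (K : choiceType) (I : finType).
Variables (p : I -> K -> mc_P m) (q : I -> K -> mc_Q m).
Hypothesis frame : forall k, \sum_i mc_alpha m (tens (p i k) (q i k)) = mc_eA m.
Variable C : finType.

(** The frame may vary with the point of [K]: for G-algebras it is translated along [K = G], for
    graded algebras it is constant. *)
Definition mc_entry (u v : (I * C) * K) (a : A) : B :=
  mc_beta m (tens (q u.1.1 u.2) (lact a (p v.1.1 v.2))).

Lemma mc_entryM (u w : (I * C) * K) (c : C) (k : K) (a a' : A) :
  \sum_(c' | c'.2 == c) (mc_entry u (c', k) a ** mc_entry (c', k) w a') =
  mc_entry u w (a ** a').
Proof.
rewrite sum_fiber_snd; under eq_bigr do rewrite mc_betaM.
have lin := mc_beta_linear (q u.1.1 u.2) (p w.1.1 w.2).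
rewrite -(linear_big lin) -amul_suml -amul_sumr frame.
by have [_ ->] := mc_eA_unit m a.
Qed.

Definition mc_spread : alg_hom (mat_alg (C * K)%type A) (mat_alg ((I * C) * K)%type B) :=
  spread (fun u v => mc_beta_linear _ _) mc_entryM.

Lemma mc_spreadE M i c k i' c' k' :
  (mc_spread M : mat_alg _ B) ((i, c, k), (i', c', k')) =
  mc_beta m (tens (q i k) (lact (M ((c, k), (c', k'))) (p i' k'))).
Proof. by []. Qed.
End MoritaContextTheory.

(** * Conjugation by rectangular matrices [a] and [b] with [ba = 1] *)

Section Conjugation.
Variables (A : algebra l) (e : A) (e_unit : is_unit e).
Variables (K : choiceType) (C C' : finType) (rho : C' -> C) (a b : C' -> K -> A).
Hypothesis ba : forall c k, \sum_(c' | rho c' == c) b c' k ** a c' k = e.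

Definition conj_entry (u v : C' * K) (x : A) : A := a u.1 u.2 ** x ** b v.1 v.2.

Lemma conj_entry_linear u v : linear (conj_entry u v).
Proof. by move=> k x y; rewrite /conj_entry amulDr amulDl amulZr amulZl. Qed.

Lemma conj_entryM u w c k x y :
  \sum_(c' | rho c' == c) (conj_entry u (c', k) x ** conj_entry (c', k) w y) =
  conj_entry u w (x ** y).
Proof.
rewrite /conj_entry.
transitivity (a u.1 u.2 ** x ** (\sum_(c' | rho c' == c) b c' k ** a c' k) **
              (y ** b w.1 w.2)); last first.
  by rewrite ba -!amulA; have [-> _] := e_unit (y ** b w.1 w.2).
by rewrite amul_sumr amul_suml; apply: eq_bigr => c' _; rewrite /= !amulA.
Qed.

Definition conj_spread := spread conj_entry_linear conj_entryM.

Lemma conj_spreadE M c k c' k' :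
  (conj_spread M : mat_alg _ A) ((c, k), (c', k')) =
  a c k ** M ((rho c, k), (rho c', k')) ** b c' k'.
Proof. by []. Qed.
End Conjugation.

Definition on_fst (X Y Z : Type) (f : X -> Y) (x : X * Z) : Y * Z := (f x.1, x.2).

Lemma on_fst_inj (X Y Z : Type) (f : X -> Y) :
  injective f -> injective (@on_fst X Y Z f).
Proof. by move=> fi [x z] [x' z'] [/fi -> ->]. Qed.

Section RoundTrip.
Variables (A B : algebra l) (m : morita_context A B) (K : choiceType) (I J : finType).
Variables (p : I -> K -> mc_P m) (q : I -> K -> mc_Q m).
Variables (q' : J -> K -> mc_Q m) (p' : J -> K -> mc_P m).
Hypothesis frame : forall k, \sum_i mc_alpha m (tens (p i k) (q i k)) = mc_eA m.
Hypothesis coframe : forall k, \sum_j mc_beta m (tens (q' j k) (p' j k)) = mc_eB m.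
Variable C : finType.

(** [C + C] supplies the factor M_2. Fibres over the left copy are points with coefficient 1; those
    over the right copy are [J * I], with the two factors of [mc_alpha_beta] as coefficients. *)
Definition trip_rho (z : C + J * (I * C)) : C + C :=
  match z with inl c => inl c | inr w => inr w.2.2 end.

Definition trip_a (z : C + J * (I * C)) (k : K) : A :=
  if z is inr w then mc_alpha m (tens (p' w.1 k) (q w.2.1 k)) else mc_eA m.

Definition trip_b (z : C + J * (I * C)) (k : K) : A :=
  if z is inr w then mc_alpha m (tens (p w.2.1 k) (q' w.1 k)) else mc_eA m.

(** Over the right copy, mixed associativity turns the sum over [j] into the action of the coframe
    sum, which is 1, on [q i k]; the frame sum over [i] remains. *)
Lemma trip_ba c k :
  \sum_(z | trip_rho z == c) trip_b z k ** trip_a z k = mc_eA m.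
Proof.
rewrite big_sumType /=; case: c => c.
  rewrite (big_pred1 c) //.
  by rewrite big_pred0 // addr0; have [-> _] := mc_eA_unit m (mc_eA m).
rewrite big_pred0 // add0r -(frame k).
rewrite (reindex_onto (fun ji : J * I => (ji.1, (ji.2, c))) (fun w => (w.1, w.2.1))) /=;
  last by move=> [j [i c']] /eqP [<-].
rewrite (eq_bigl predT) => [|[j i]]; last by rewrite /= !eqxx.
rewrite -(pair_big predT predT (fun j i => mc_alpha m (tens (p i k) (q' j k)) **
  mc_alpha m (tens (p' j k) (q i k)))) exchange_big /=.
apply: eq_bigr => i _.
under eq_bigr do rewrite -mc_alphaZr -mc_assocQ.
have lin : linear (fun b => mc_alpha m (tens (p i k) (lact b (q i k)))).
  by move=> x b b'; rewrite lact_linl tensDr tensZr linearP.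
by rewrite -(linear_big lin) coframe; have [-> _] := mc_Q_unitary (q i k).
Qed.

(* On the first summand C this is the corner inclusion, on the second one the composite
   psi \o phi (trip_inl, trip_inr). *)
Definition trip := conj_spread (mc_eA_unit m) trip_ba.

Notation phi := (mc_spread frame C).
Notation psi := (mc_spread (m := mc_swap m) coframe (I * C)%type).

Lemma trip_inl M
    (f : injective (@on_fst _ _ K (@inl C C)))
    (g : injective (@on_fst _ _ K (@inl C (J * (I * C))))) :
  trip (mat_map A f M) = mat_map A g M.
Proof.
apply: finsupp_ext => -[[[c|w] k] [[c'|w'] k']]; rewrite [LHS]conj_spreadE.
- rewrite [RHS](mat_map_in g M (c, k) (c', k')).
  transitivity (mc_eA m ** M ((c, k), (c', k')) ** mc_eA m).
    congr (_ ** _ ** _); exact: (mat_map_in f M (c, k) (c', k')).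
  have [-> _] := mc_eA_unit m (M ((c, k), (c', k'))).
  by have [_ ->] := mc_eA_unit m (M ((c, k), (c', k'))).
(* In the three other blocks an index lies in the right summand, outside the images of both
   inclusions, so both entries are 0. *)
all: by rewrite ?[RHS]mat_map_notin ?[X in _ ** X ** _]mat_map_notin ?amul0r ?amul0l //;
  try (by left=> -[]); right=> -[].
Qed.

Lemma trip_inr M
    (f : injective (@on_fst _ _ K (@inr C C)))
    (g : injective (@on_fst _ _ K (@inr C (J * (I * C))))) :
  trip (mat_map A f M) = mat_map A g (psi (phi M)).
Proof.
apply: finsupp_ext => -[[[c|w] k] [[c'|w'] k']]; rewrite [LHS]conj_spreadE.
(* Only this block, with both indices in the right summand, can be nonzero. *)
4: {
  case: w w' => [j [i c]] [j' [i' c']].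
  rewrite [RHS](mat_map_in g _ ((j, (i, c)), k) ((j', (i', c')), k')).
  rewrite [RHS](mc_alpha_beta (p' j k) (q i k) (M ((c, k), (c', k'))) (p i' k') (q' j' k')).
  congr (_ ** _ ** _); exact: (mat_map_in f M (c, k) (c', k')). }
all: by rewrite ?[RHS]mat_map_notin ?[X in _ ** X ** _]mat_map_notin ?amul0r ?amul0l //;
  try (by left=> -[]); right=> -[].
Qed.
End RoundTrip.
End Matrices.

(** * G-algebras *)

Section Equivariant.
Variables (l : comPzRingType) (G : groupType).

Record gembedding (S T : gset G) := GEmbedding {
  gemb_fun :> S -> T;
  gemb_inj : injective gemb_fun;
  gemb_eq : forall g s, gemb_fun (sact g s) = sact g (gemb_fun s) }.
Arguments gemb_inj {S T} _.
Arguments gemb_eq {S T} _.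

Lemma gembedding_ext S T (f f' : gembedding S T) : f =1 f' -> f = f'.
Proof.
case: f f' => [f fi fe] [f' fi' fe'] /= /funext ff; subst f'.
by congr GEmbedding; apply: Prop_irrelevance.
Qed.

Definition gembedding_id S : gembedding S S.
Proof. by exists idfun. Defined.

Definition gembedding_comp S T U (g : gembedding T U) (f : gembedding S T) :
  gembedding S U.
Proof.
exists (fun s => g (f s)); first by move=> s s' /gemb_inj /gemb_inj.
by move=> x s; rewrite !gemb_eq.
Defined.

Definition gset_category : category.
Proof.
by refine (@Category (gset G) gembedding gembedding_id gembedding_comp _ _ _);
  intros; apply: gembedding_ext.
Defined.

Definition gprod (C : choiceType) (T : gset G) : gset G.
Proof.
exists (C * T)%type (fun g x => (x.1, sact g x.2)) => [[c t]|g h [c t]] /=.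
  by rewrite sact1.
by rewrite sactM.
Defined.

Definition gregular : gset G := GSet (@mul1g G) (fun g h s => esym (mulgA g h s)).

Definition gprod_map (C C' : choiceType) (T : gset G) (f : C -> C') (fi : injective f) :
  gembedding (gprod C T) (gprod C' T) :=
  @GEmbedding (gprod C T) (gprod C' T) (on_fst f) (on_fst_inj fi) (fun _ _ => erefl).

Definition gslice (T : gset G) (n : nat) : gembedding T (gprod nat T).
Proof. by exists (pair n : T -> gprod nat T) => [s t []|]. Defined.

Definition gcopies : copies gset_category.
Proof.
exists (gprod nat : gset_category -> gset_category) gslice => T T' h f hi.
have inj : injective (fun x : gprod nat T => (h x.1, f x.1 x.2) : gprod nat T').
  by move=> [n t] [n' t'] [/hi ->] /gemb_inj ->.
have eqv g (x : gprod nat T) :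
    (h (sact g x).1, f (sact g x).1 (sact g x).2) =
    sact g ((h x.1, f x.1 x.2) : gprod nat T').
  by congr pair; apply: (gemb_eq (f x.1)).
by exists (@GEmbedding (gprod nat T) (gprod nat T') _ inj eqv) => n; apply: gembedding_ext.
Defined.

(** [pickle] sends each element of [C'] to a copy of its own, inside which [c0] is the base point.
    [embedding_iso] asks only that some embedding exist. *)
Lemma gprod_copies (C C' : countType) (c0 : C) :
  gembedding (gprod C' gregular) (gprod nat (gprod C gregular)).
Proof.
exists (fun x => (pickle x.1, (c0, x.2)) : gprod nat (gprod C gregular)) => //.
by move=> [c g] [c' g'] [/(pcan_inj pickleK) -> ->].
Qed.

(** The functor [Y] of the countable-copies argument, for fixed coefficients [A]. *)
Definition gmat_functor (A : galgebra l G) (D : category) (X : functor (GAlg l G) D) :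
  functor gset_category D.
Proof.
exists (fun T : gset_category => X (mat_galg T A))
  (fun S T (f : gembedding S T) => fmap X (mat_gmap A (gemb_inj f) (gemb_eq f))).
  move=> S; rewrite -[RHS]fmap1; congr (fmap X _); apply: ghom_ext => M.
  exact: mat_map_id.
move=> S T U g f; rewrite -[RHS]fmap_comp; congr (fmap X _); apply: ghom_ext => M.
exact: mat_map_comp.
Defined.

Lemma ghom_iso (A B : galgebra l G) (f : @hom (GAlg l G) A B) (g : @hom (GAlg l G) B A) :
  cancel (f : ghom A B) (g : ghom B A) -> cancel (g : ghom B A) (f : ghom A B) -> is_iso f.
Proof. by move=> fg gf; exists g; split; apply: ghom_ext. Qed.

Section Stability.
Variables (D : category) (X : functor (GAlg l G) D).
Hypotheses (matN : gmatN_stable X) (stab : gstable X).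

Definition gcurry (T : gset G) (A : galgebra l G) :
  ghom (mat_galg (gprod nat T) A) (matN_galg (mat_galg T A)).
Proof.
exists (curry nat T A : alg_hom _ (matN_galg (mat_galg T A))) => g M.
by apply: finsupp_ext => -[i j]; apply: finsupp_ext => -[s t].
Defined.

Definition guncurry (T : gset G) (A : galgebra l G) :
  ghom (matN_galg (mat_galg T A)) (mat_galg (gprod nat T) A).
Proof.
exists (uncurry nat T A : alg_hom (matN_galg (mat_galg T A)) _) => g N.
by apply: finsupp_ext => -[[i s] [j t]].
Defined.

(** The base case is slice 1 because M_N-stability is stated with the corner E_{1,1}, to which
    currying carries it. *)
Lemma gslice_iso (T : gset G) (A : galgebra l G) :
  inverts (gmat_functor A X) (gslice T 1).
Proof.
have ic : is_iso (gcurry T A : @hom (GAlg l G) _ _).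
  by apply: (ghom_iso (g := guncurry T A)); [apply: curryK|apply: uncurryK].
apply: (is_iso_cancel_l (fmap_iso X ic)); have := matN (mat_galg T A).
rewrite (_ : matN_gincl _ = (gcurry T A : @hom (GAlg l G) _ _) \o
  mat_gmap A (gemb_inj (gslice T 1)) (gemb_eq (gslice T 1)))%cat.
  by rewrite /inverts fmap_comp.
by apply: ghom_ext => M; symmetry; apply: curry_map.
Qed.

Lemma gprod_map_iso (A : galgebra l G) (C C' : countType) (f : C -> C')
    (fi : injective f) (c0 : C) :
  inverts (gmat_functor A X) (gprod_map gregular fi).
Proof.
apply: (embedding_iso (N := gcopies)) => [T|]; first exact: gslice_iso.
exact: gprod_copies.
Qed.

(** A fixed point and a free orbit, together of cardinality card(G)+1, the bound in G-stability. *)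
Definition goption : gset G.
Proof.
exists (option G) (fun g => omap (fun h => g * h)%g) => [[h|]|g h [k|]] //=.
  by rewrite mul1g.
by rewrite mulgA.
Defined.

Definition gpoint_goption : gembedding (trivial_gset G unit) goption.
Proof. by exists (fun _ => None : goption) => [[] []|]. Defined.

Definition gregular_goption : gembedding (gprod unit gregular) goption.
Proof. by exists (fun x => Some x.2 : goption) => [[[] g] [[] h] [->]|]. Defined.

(** For nontrivial [G] neither the point nor the regular G-set embeds in the other, but both embed
    in [goption]: this gives a zigzag of stability isomorphisms. *)
Lemma gregular_matrices (A : galgebra l G) :
  isomorphic (X A) (X (mat_galg (gprod unit gregular) A)).
Proof.
pose pt := trivial_gset G unit.
have ci (S : gset G) (f : gembedding S goption) (s : S) : inverts (gmat_functor A X) f.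
  by apply: stab; [exists s|apply: card_lexx].
have incl_eq g a : (mat_incl A tt : alg_hom A (mat_galg pt A)) (gact g a) =
    gact g ((mat_incl A tt : alg_hom A (mat_galg pt A)) a).
  by rewrite [RHS]mat_gact_unit.
have proj_eq g M : (point_proj A : alg_hom (mat_galg pt A) A) (gact g M) =
    gact g ((point_proj A : alg_hom (mat_galg pt A) A) M).
  by [].
have i1 : is_iso (GHom incl_eq : @hom (GAlg l G) A (mat_galg pt A)).
  apply: (ghom_iso (g := GHom proj_eq)); [exact: point_inclK|exact: point_entryK].
apply: (@isomorphic_trans _ _ (X (mat_galg pt A))).
  by exists (fmap X (GHom incl_eq : @hom (GAlg l G) A (mat_galg pt A))); apply: fmap_iso.
apply: (@isomorphic_trans _ _ (X (mat_galg goption A))).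
  by exists (fmap (gmat_functor A X) gpoint_goption); exact: (ci _ gpoint_goption tt).
apply: isomorphic_sym.
by exists (fmap (gmat_functor A X) gregular_goption); exact: (ci _ gregular_goption (tt, 1%g)).
Qed.

(** * Equivariant Morita equivalences *)

Section GMorita.
Variables (R S : unital_galgebra l G) (m : gmorita R S).

Definition gm_context : morita_context S R :=
  MoritaContext (@gone_unit _ _ S) (@gone_unit _ _ R) (@gm_P_unitary _ _ _ _ m)
    (@gm_Q_unitary _ _ _ _ m) (@gm_alpha_bimod _ _ _ _ m) (@gm_beta_bimod _ _ _ _ m)
    (@gm_assocP _ _ _ _ m) (@gm_assocQ _ _ _ _ m).

Definition gm_swap : gmorita S R :=
  @GMorita l G S R (gm_Q m) (gm_P m) (@gm_Q_unitary _ _ _ _ m) (@gm_P_unitary _ _ _ _ m)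
    (@gm_Qact _ _ _ _ m) (@gm_Pact _ _ _ _ m) (gm_Q_gmodule m) (gm_P_gmodule m)
    (@gm_Q_eq _ _ _ _ m) (@gm_P_eq _ _ _ _ m) (gm_beta m) (gm_alpha m)
    (gm_beta_bij m) (gm_alpha_bij m) (@gm_beta_bimod _ _ _ _ m) (@gm_alpha_bimod _ _ _ _ m)
    (@gm_beta_eq _ _ _ _ m) (@gm_alpha_eq _ _ _ _ m)
    (@gm_assocQ _ _ _ _ m) (@gm_assocP _ _ _ _ m).

Lemma gm_P_lact g (s : S) (p : gm_P m) :
  gm_Pact g (lact s p) = lact (gact g s) (gm_Pact g p).
Proof.
have [_ e] := gm_P_unitary (lact s p).
by rewrite -{1}e gm_P_eq gact_one; have [_ ->] := gm_P_unitary (lact (gact g s) (gm_Pact g p)).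
Qed.

(** [gm_alpha] is surjective, and every tensor is a finite sum of pure tensors. *)
Lemma gm_frame : exists n (p : 'I_n.+1 -> gm_P m) (q : 'I_n.+1 -> gm_Q m),
  \sum_i gm_alpha m (tens (p i) (q i)) = gone S.
Proof.
have [inv _ aK] := gm_alpha_bij m.
have [s es] := tensor_span (inv (gone S)).
(* The pair of zeros at index 0 contributes nothing and keeps the index set nonempty, which later
   provides base points. *)
exists (size s), (fun i => (nth (0, 0) ((0, 0) :: s) i).1),
  (fun i => (nth (0, 0) ((0, 0) :: s) i).2).
rewrite -[RHS]aK es linear_sum big_ord_recl /=.
rewrite tens0l linear0 add0r.
by rewrite (big_nth (0, 0)) big_mkord.
Qed.

Variables (I : finType) (p : I -> gm_P m) (q : I -> gm_Q m).
Hypothesis frame : \sum_i gm_alpha m (tens (p i) (q i)) = gone S.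

(** [gm_alpha] is equivariant and 1 is fixed, so a translated frame is again a frame. *)
Lemma gm_frame_act (k : G) :
  \sum_i mc_alpha gm_context (tens (gm_Pact k (p i)) (gm_Qact k (q i))) = mc_eA gm_context.
Proof.
under eq_bigr do rewrite gm_alpha_eq.
by rewrite -gact_sum [X in gact k X]frame gact_one.
Qed.

Variable C : finType.

Definition gm_spread :
  ghom (mat_galg (gprod C gregular) S) (mat_galg (gprod (I * C)%type gregular) R).
Proof.
exists (mc_spread (m := gm_context) gm_frame_act C) => g M.
apply: finsupp_ext => -[[[i c] k] [[i' c'] k']]; rewrite [RHS]mat_gactE.
rewrite [LHS]mc_spreadE [X in _ = gact g X]mc_spreadE /= -gm_beta_eq gm_P_lact.
(* The action reads entries at indices translated by [g^-1], and [g] moves the frame at [g^-1 * k]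
   to the frame at [k]. *)
have mK (x : G) : (g * (g^-1 * x))%g = x by rewrite mulgA mulgV mul1g.
by rewrite -(gmodM (gm_P_gmodule m)) -(gmodM (gm_Q_gmodule m)) !mK.
Defined.
End GMorita.

Section GRoundTrip.
Variables (R S : unital_galgebra l G) (m : gmorita R S) (I J : finType).
Variables (p : I -> gm_P m) (q : I -> gm_Q m) (q' : J -> gm_Q m) (p' : J -> gm_P m).
Hypothesis frame : \sum_i gm_alpha m (tens (p i) (q i)) = gone S.
Hypothesis coframe : \sum_j gm_beta m (tens (q' j) (p' j)) = gone R.
Variable C : finType.

Let phi := gm_spread frame C.
Let psi := gm_spread (m := gm_swap m) coframe (I * C)%type.
Let C2 : finType := (C + C)%type.
Let C3 : finType := (C + J * (I * C))%type.

Definition gm_trip : ghom (mat_galg (gprod C2 gregular) S) (mat_galg (gprod C3 gregular) S).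
Proof.
exists (trip (m := gm_context m) (gm_frame_act frame)
  (gm_frame_act (m := gm_swap m) coframe) C) => g M.
apply: finsupp_ext => -[[z k] [z' k']]; rewrite [RHS]mat_gactE.
rewrite [LHS]conj_spreadE [X in _ = gact g X]conj_spreadE !gact_mul.
have mK (x : G) : (g * (g^-1 * x))%g = x by rewrite mulgA mulgV mul1g.
congr (_ ** _ ** _).
  case: z => [c|w] /=; first by rewrite gact_one.
  by rewrite -gm_alpha_eq -(gmodM (gm_P_gmodule m)) -(gmodM (gm_Q_gmodule m)) mK.
case: z' => [c|w] /=; first by rewrite gact_one.
by rewrite -gm_alpha_eq -(gmodM (gm_P_gmodule m)) -(gmodM (gm_Q_gmodule m)) mK.
Defined.

(** [il2] and [ir2] agree under [Y], so precomposing [gm_trip] with either gives the isomorphism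
    induced by [il3]. With [ir2] this is also the composite followed by the isomorphism induced by
    [ir3], which cancels. [i0], [j0], [c0] are base points of the index sets. *)
Lemma gm_trip_iso (i0 : I) (j0 : J) (c0 : C) :
  is_iso (fmap X (psi : @hom (GAlg l G) _ _) \o fmap X (phi : @hom (GAlg l G) _ _))%cat.
Proof.
pose Y := gmat_functor S X.
pose il2 := gprod_map gregular (@inl_inj C C).
pose ir2 := gprod_map gregular (@inr_inj C C).
pose il3 := gprod_map gregular (@inl_inj C (J * (I * C))%type).
pose ir3 := gprod_map gregular (@inr_inj C (J * (I * C))%type).
have il : (fmap X (gm_trip : @hom (GAlg l G) _ _) \o fmap Y il2)%cat = fmap Y il3.
  by rewrite -(fmap_comp X); congr (fmap X _); apply: ghom_ext => M; apply: trip_inl.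
have ir : (fmap X (gm_trip : @hom (GAlg l G) _ _) \o fmap Y ir2)%cat =
    (fmap Y ir3 \o (fmap X (psi : @hom (GAlg l G) _ _) \o fmap X (phi : @hom (GAlg l G) _ _)))%cat.
  by rewrite -!(fmap_comp X); congr (fmap X _); apply: ghom_ext => M; apply: trip_inr.
apply: (@is_iso_cancel_l _ _ _ _ (fmap Y ir3)).
  exact: (@gprod_map_iso S _ _ _ _ ((j0, (i0, c0)) : J * (I * C))).
rewrite -ir (embeddings_eq (N := gcopies) _ ir2 il2); last by move=> T; apply: gslice_iso.
by rewrite il; apply: (gprod_map_iso _ _ c0).
Qed.
End GRoundTrip.

Lemma gmorita_invariant (R S : unital_galgebra l G) :
  gmorita R S -> isomorphic (X (ugalg R)) (X (ugalg S)).
Proof.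
move=> m; apply: isomorphic_sym.
have [n [p [q frame]]] := gm_frame m.
have [n' [q' [p' coframe]]] := gm_frame (gm_swap m).
pose C : finType := unit.
pose Z : finType := ('I_n.+1 * unit)%type.
apply: isomorphic_trans (gregular_matrices S) _.
apply: (@isomorphic_trans _ _ (X (mat_galg (gprod Z gregular) R))).
  exists (fmap X (gm_spread frame C : @hom (GAlg l G) _ _)).
  (* Three maps in a row, from matrices over [S] to [R], to [S] and to [R]: the return map of the
     first trip is the outgoing map of the second, which has [Z] in place of [C]. *)
  apply: is_iso_2of6 (gm_trip_iso frame coframe ord0 ord0 tt)
    (gm_trip_iso (m := gm_swap m) coframe frame ord0 ord0 ((ord0, tt) : Z)).
apply: isomorphic_sym.
apply: isomorphic_trans (gregular_matrices R) _.
have inj : injective (fun x : unit => (ord0, x) : Z) by move=> [] [].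
exists (fmap (gmat_functor R X) (gprod_map gregular inj)); exact: gprod_map_iso.
Qed.
End Stability.
End Equivariant.

(** * Graded algebras *)

Section Graded.
Variables (l : comPzRingType) (G : groupType).

Record grembedding (S T : grset G) := GrEmbedding {
  gremb_fun :> S -> T;
  gremb_inj : injective gremb_fun;
  gremb_deg : forall s, sdeg (gremb_fun s) = sdeg s }.
Arguments gremb_inj {S T} _.
Arguments gremb_deg {S T} _.

Lemma grembedding_ext S T (f f' : grembedding S T) : f =1 f' -> f = f'.
Proof.
case: f f' => [f fi fe] [f' fi' fe'] /= /funext ff; subst f'.
by congr GrEmbedding; apply: Prop_irrelevance.
Qed.

Definition grembedding_id S : grembedding S S.
Proof. by exists idfun. Defined.

Definition grembedding_comp S T U (g : grembedding T U) (f : grembedding S T) :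
  grembedding S U.
Proof.
exists (fun s => g (f s)); first by move=> s s' /gremb_inj /gremb_inj.
by move=> s; rewrite !gremb_deg.
Defined.

Definition grset_category : category.
Proof.
by refine (@Category (grset G) grembedding grembedding_id grembedding_comp _ _ _);
  intros; apply: grembedding_ext.
Defined.

(* The twist by d absorbs the degrees of the elements p_i and q_i. *)
Definition grprod (C : choiceType) (d : C -> G) (T : grset G) : grset G :=
  @GrSet G (C * T)%type (fun x => sdeg x.2 * d x.1)%g.

Definition grregular : grset G := @GrSet G G id.

Definition grprod_map (C C' : choiceType) (d : C -> G) (d' : C' -> G) (T : grset G)
    (f : C -> C') (fi : injective f) (fd : forall c, d' (f c) = d c) :
  grembedding (grprod d T) (grprod d' T).
Proof.
exists (on_fst f : grprod d T -> grprod d' T); first exact: on_fst_inj.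
by move=> x /=; rewrite fd.
Defined.

Definition grcopy (T : grset G) : grset G := grprod (fun _ : nat => 1%g) T.

Definition grslice (T : grset G) (n : nat) : grembedding T (grcopy T).
Proof.
by exists (pair n : T -> grcopy T) => [s t []|s] //=; rewrite mulg1.
Defined.

Definition grcopies : copies grset_category.
Proof.
exists (grcopy : grset_category -> grset_category) grslice => T T' h f hi.
have inj : injective (fun x : grcopy T => (h x.1, f x.1 x.2) : grcopy T').
  by move=> [n t] [n' t'] [/hi ->] /gremb_inj ->.
have deg (x : grcopy T) : sdeg ((h x.1, f x.1 x.2) : grcopy T') = sdeg x.
  by rewrite /= (gremb_deg (f x.1)).
by exists (GrEmbedding inj deg) => n; apply: grembedding_ext.
Defined.

(** As for G-sets, but a right translation in [G] also corrects the degree: it cancels the twist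
    [d c0] and puts [d' x.1] in its place. *)
Lemma grprod_copies (C C' : countType) (d : C -> G) (d' : C' -> G) (c0 : C) :
  grembedding (grprod d' grregular) (grcopy (grprod d grregular)).
Proof.
exists (fun x => (pickle x.1, (c0, x.2 * d' x.1 * (d c0)^-1)%g) : grcopy (grprod d grregular)).
  by move=> [c g] [c' g'] [/(pcan_inj pickleK) ->] /mulIg /mulIg ->.
by move=> [c g] /=; rewrite mulg1 mulgVK.
Qed.

Definition grmat_functor (A : gralgebra l G) (D : category) (X : functor (GrAlg l G) D) :
  functor grset_category D.
Proof.
exists (fun T : grset_category => X (mat_gralg T A))
  (fun S T (f : grembedding S T) => fmap X (mat_grmap A (gremb_inj f) (gremb_deg f))).
  move=> S; rewrite -[RHS]fmap1; congr (fmap X _); apply: grhom_ext => M.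
  exact: mat_map_id.
move=> S T U g f; rewrite -[RHS]fmap_comp; congr (fmap X _); apply: grhom_ext => M.
exact: mat_map_comp.
Defined.

Lemma grhom_iso (A B : gralgebra l G) (f : @hom (GrAlg l G) A B) (g : @hom (GrAlg l G) B A) :
  cancel (f : grhom A B) (g : grhom B A) -> cancel (g : grhom B A) (f : grhom A B) -> is_iso f.
Proof. by move=> fg gf; exists g; split; apply: grhom_ext. Qed.

Definition grcurry (T : grset G) (A : gralgebra l G) :
  grhom (mat_gralg (grcopy T) A) (matN_gralg (mat_gralg T A)).
Proof.
exists (curry nat T A : alg_hom _ (matN_gralg (mat_gralg T A))) => g M hM i j s t.
have := hM (i, s) (j, t); by rewrite /= !mulg1 invg1 mul1g.
Defined.

Definition gruncurry (T : grset G) (A : gralgebra l G) :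
  grhom (matN_gralg (mat_gralg T A)) (mat_gralg (grcopy T) A).
Proof.
exists (uncurry nat T A : alg_hom (matN_gralg (mat_gralg T A)) _) => g N hN [i s] [j t].
have := hN i j s t; by rewrite /= !mulg1 invg1 mul1g.
Defined.

(** * Homogeneous components *)

Section HomogeneousParts.
Variables (V : lmodType l) (Vg : G -> set V).
Hypothesis Vgr : is_grading Vg.

(** Lists of degrees with elements allow the decompositions of two tensor factors to be combined by
    listing all pairs. *)
Lemma homogeneous_sum (v : V) : exists r : seq (G * V),
  (forall x, x \in r -> Vg x.1 x.2) /\ v = \sum_(x <- r) x.2.
Proof.
have [f [hf ->]] := gr_exists Vgr v; have [r [_ _ ->]] := finsupp_fsum f.
exists [seq (g, f g) | g <- r]; rewrite big_map.
by split=> // x /mapP [g _ ->] /=.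
Qed.

Lemma gr_big (J : eqType) (r : seq J) (P : pred J) (F : J -> V) g :
  (forall j, j \in r -> P j -> Vg g (F j)) -> Vg g (\sum_(j <- r | P j) F j).
Proof.
move=> h; rewrite big_seq_cond; apply: big_ind => [|u v hu hv|j /andP [jr Pj]].
- exact: gr0 Vgr g.
- by rewrite -[u]scale1r; apply: gr_linear Vgr _ _ _ _ hu hv.
- exact: h.
Qed.

(** [f] is the difference of two homogeneous decompositions of [v]: the given sum sorted by degree,
    and [v] alone in degree [g]. Its total is 0, so uniqueness gives [f g = 0]. *)
Lemma homogeneous_part (J : eqType) (r : seq J) (deg : J -> G) (F : J -> V) g :
  (forall j, j \in r -> Vg (deg j) (F j)) -> Vg g (\sum_(j <- r) F j) ->
  \sum_(j <- r) F j = \sum_(j <- r | deg j == g) F j.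
Proof.
move=> hF; set v := \sum_(j <- r) F j => hv.
pose f h := \sum_(j <- r | deg j == h) F j - (if h == g then v else 0).
pose q := undup (g :: [seq deg j | j <- r]).
have fq h : f h != 0 -> h \in q.
  apply: contraR; rewrite mem_undup inE negb_or /f => /andP [/negbTE -> hr].
  rewrite subr0 big_seq_cond big_pred0 // => j.
  by apply: contraNF hr => /andP [jr /eqP <-]; apply: map_f.
have fP : f \in finite_supp G V by apply/finite_suppP; exists q.
suff: f g = 0 by rewrite /f eqxx => /eqP; rewrite subr_eq0 => /eqP <-.
apply: (gr_unique Vgr (f := FinSupp fP)) => [h|].
  rewrite /= /f -scaleN1r addrC; apply: gr_linear Vgr _ _ _ _ _ _.
    by case: ifP => [/eqP ->|_] //; apply: gr0 Vgr h.
  by apply: gr_big => j /hF + /eqP => /[swap] ->.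
rewrite (fsum_seq (r := q)) ?undup_uniq //= sumrB -big_mkcond /=.
have -> : \sum_(h <- q | h == g) v = v.
  by rewrite -big_filter filter_pred1_uniq ?undup_uniq ?mem_undup ?mem_head // big_seq1.
apply/eqP; rewrite subr_eq0; apply/eqP.
rewrite (exchange_big_dep predT) //= /v [LHS]big_seq [RHS]big_seq.
apply: eq_bigr => j jr.
rewrite (eq_bigl (pred1 (deg j))) => [|h]; last by rewrite /= eq_sym.
by rewrite -big_filter filter_pred1_uniq ?undup_uniq ?big_seq1 // mem_undup inE map_f ?orbT.
Qed.
End HomogeneousParts.

Section GrStability.
Variables (D : category) (X : functor (GrAlg l G) D).
Hypotheses (matN : grmatN_stable X) (stab : grstable X).

Lemma grslice_iso (T : grset G) (A : gralgebra l G) :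
  inverts (grmat_functor A X) (grslice T 1).
Proof.
have ic : is_iso (grcurry T A : @hom (GrAlg l G) _ _).
  by apply: (grhom_iso (g := gruncurry T A)); [apply: curryK|apply: uncurryK].
apply: (is_iso_cancel_l (fmap_iso X ic)); have := matN (mat_gralg T A).
rewrite (_ : matN_grincl _ = (grcurry T A : @hom (GrAlg l G) _ _) \o
  mat_grmap A (gremb_inj (grslice T 1)) (gremb_deg (grslice T 1)))%cat.
  by rewrite /inverts fmap_comp.
by apply: grhom_ext => M; symmetry; apply: curry_map.
Qed.

Lemma grprod_embedding_iso (A : gralgebra l G) (C C' : countType) (d : C -> G) (d' : C' -> G)
    (f : grembedding (grprod d grregular) (grprod d' grregular)) (c0 : C) :
  inverts (grmat_functor A X) f.
Proof.
apply: (embedding_iso (N := grcopies)) => [T|]; first exact: grslice_iso.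
exact: grprod_copies.
Qed.

(** One embedding suffices here: a point of degree 1 embeds in the regular graded set, whose size
    meets the bound card(G). *)
Lemma grregular_matrices (A : gralgebra l G) :
  isomorphic (X A) (X (mat_gralg (grprod (fun _ : unit => 1%g) grregular) A)).
Proof.
pose pt := trivial_grset G unit; set T := grprod _ _.
have [f] : inhabited (grembedding pt T).
  by constructor; exists (fun _ => (tt, 1%g) : T) => [[] []|s] //=; rewrite mulg1.
have fi : inverts (grmat_functor A X) f.
  apply: stab; first by exists tt.
  have := @card_ge_preimage (unit * G)%type G [set: G] snd.
  by apply=> -[[] g] [[] h] _ _ /= ->.
have incl_deg g (a : A) : gr g a ->
    gr g ((mat_incl A tt : alg_hom A (mat_gralg pt A)) a).
  by move=> ha; have := @mat_gr_unit _ _ pt A tt tt g a ha; rewrite /= mul1g invg1 mulg1.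
have proj_deg g (M : mat_gralg pt A) : gr g M ->
    gr g ((point_proj A : alg_hom (mat_gralg pt A) A) M).
  by move=> hM; have := hM tt tt; rewrite /= invg1 mul1g mulg1.
have i1 : is_iso (GrHom incl_deg : @hom (GrAlg l G) A (mat_gralg pt A)).
  apply: (grhom_iso (g := GrHom proj_deg)); [exact: point_inclK|exact: point_entryK].
apply: (@isomorphic_trans _ _ (X (mat_gralg pt A))).
  by exists (fmap X (GrHom incl_deg : @hom (GrAlg l G) A (mat_gralg pt A))); apply: fmap_iso.
by exists (fmap (grmat_functor A X) f).
Qed.

(** * Graded Morita equivalences *)

Section GrMorita.
Variables (R S : unital_gralgebra l G) (m : grmorita R S).

Definition grm_context : morita_context S R :=
  MoritaContext (@grone_unit _ _ S) (@grone_unit _ _ R) (@grm_P_unitary _ _ _ _ m)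
    (@grm_Q_unitary _ _ _ _ m) (@grm_alpha_bimod _ _ _ _ m) (@grm_beta_bimod _ _ _ _ m)
    (@grm_assocP _ _ _ _ m) (@grm_assocQ _ _ _ _ m).

Definition grm_swap : grmorita S R :=
  @GrMorita l G S R (grm_Q m) (grm_P m) (@grm_Q_unitary _ _ _ _ m)
    (@grm_P_unitary _ _ _ _ m) (@grm_Qgr _ _ _ _ m) (@grm_Pgr _ _ _ _ m)
    (grm_Q_grading m) (grm_P_grading m) (@grm_Q_deg _ _ _ _ m) (@grm_P_deg _ _ _ _ m)
    (grm_beta m) (grm_alpha m) (grm_beta_bij m) (grm_alpha_bij m)
    (@grm_beta_bimod _ _ _ _ m) (@grm_alpha_bimod _ _ _ _ m)
    (@grm_beta_deg _ _ _ _ m) (@grm_alpha_deg _ _ _ _ m)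
    (@grm_assocQ _ _ _ _ m) (@grm_assocP _ _ _ _ m).

Lemma grm_P_lact g h (s : S) (p : grm_P m) :
  gr g s -> grm_Pgr h p -> grm_Pgr (g * h)%g (lact s p).
Proof.
move=> hs hp; have [_ e] := grm_P_unitary (lact s p).
by rewrite -e -[(g * h)%g]mulg1; apply: grm_P_deg => //; apply: gr_one.
Qed.

(* The component of degree 1 of an arbitrary decomposition of the unit of S. *)
Lemma grm_frame : exists n (e : 'I_n.+1 -> G) (p : 'I_n.+1 -> grm_P m) (q : 'I_n.+1 -> grm_Q m),
  [/\ forall i, grm_Pgr (e i) (p i), forall i, grm_Qgr (e i)^-1%g (q i) &
      \sum_i grm_alpha m (tens (p i) (q i)) = grone S].
Proof.
have [inv _ aK] := grm_alpha_bij m.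
have [s es] := tensor_span (inv (grone S)).
have [hp hpE] := choice (homogeneous_sum (grm_P_grading m)).
have [hq hqE] := choice (homogeneous_sum (grm_Q_grading m)).
pose L := flatten [seq [seq (x, y) | x <- hp z.1, y <- hq z.2] | z <- s].
pose F (z : (G * grm_P m) * (G * grm_Q m)) := grm_alpha m (tens z.1.2 z.2.2).
have LP z : z \in L -> grm_Pgr z.1.1 z.1.2 /\ grm_Qgr z.2.1 z.2.2.
  move=> /flattenP [r /mapP [w _ ->]] /allpairsP [[x y] [/= xp yq ->]] /=.
  by split; [case: (hpE w.1) => h _; apply: h|case: (hqE w.2) => h _; apply: h].
have sumL : grone S = \sum_(z <- L) F z.
  rewrite -[LHS]aK es linear_sum /L big_flatten big_map; apply: eq_bigr => -[p q] _ /=.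
  rewrite big_allpairs; have [_ {1}->] := hpE p; have [_ {1}->] := hqE q.
  have linP q0 : linear (fun p0 => grm_alpha m (tens p0 q0)).
    by move=> k u v; rewrite tensDl tensZl linearP.
  have linQ p0 : linear (fun q0 => grm_alpha m (tens p0 q0)).
    by move=> k u v; rewrite tensDr tensZr linearP.
  rewrite (linear_big (linP _)); apply: eq_bigr => x _.
  by rewrite (linear_big (linQ _)).
have := @homogeneous_part _ _ (gr_grading S) _ L (fun z => z.1.1 * z.2.1)%g F 1%g.
rewrite -sumL => /(_ _ (gr_one S)) sumE.
pose L1 := [seq z <- L | (z.1.1 * z.2.1 == 1)%g].
(* Zero vectors of degree 1 satisfy the degree conditions and, prepended to [L1], keep the index set
   nonempty. *)
pose z0 : (G * grm_P m) * (G * grm_Q m) := ((1%g, 0), (1%g, 0)).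
have L1P i : let z := nth z0 (z0 :: L1) i in grm_Pgr z.1.1 z.1.2 /\ grm_Qgr z.1.1^-1%g z.2.2.
  have [ltn|/(nth_default z0) ->] := ltnP i (size (z0 :: L1)); last first.
    by rewrite /= invg1; split; [apply: gr0 (grm_P_grading m) _|apply: gr0 (grm_Q_grading m) _].
  have := mem_nth z0 ltn; rewrite inE => /orP [/eqP ->|].
    by rewrite /= invg1; split; [apply: gr0 (grm_P_grading m) _|apply: gr0 (grm_Q_grading m) _].
  rewrite mem_filter => /andP [/eqP e /LP [hP hQ]]; split=> //.
  rewrite (_ : _^-1 = (nth z0 (z0 :: L1) i).2.1)%g //.
  by apply: (@mulgI _ (nth z0 (z0 :: L1) i).1.1); rewrite mulgV e.
exists (size L1), (fun i => (nth z0 (z0 :: L1) i).1.1),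
  (fun i => (nth z0 (z0 :: L1) i).1.2), (fun i => (nth z0 (z0 :: L1) i).2.2).
split=> [i|i|]; [by case: (L1P i)|by case: (L1P i)|].
rewrite sumE => [|z /LP [hP hQ]]; last exact: grm_alpha_deg.
rewrite big_ord_recl /= tens0l linear0 add0r.
by rewrite -[RHS]big_filter (big_nth z0) big_mkord.
Qed.

Variables (I : finType) (e : I -> G) (p : I -> grm_P m) (q : I -> grm_Q m).
Hypotheses (p_deg : forall i, grm_Pgr (e i) (p i))
  (q_deg : forall i, grm_Qgr (e i)^-1%g (q i)).
Hypothesis frame : \sum_i grm_alpha m (tens (p i) (q i)) = grone S.
Variables (C : finType) (d : C -> G).

(** The index [((i, c), k)] has degree [k * d c * e i]; its last factor accounts for the degrees of
    [q i] on the left and [p i] on the right of an entry. *)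
Definition grm_spread :
  grhom (mat_gralg (grprod d grregular) S)
    (mat_gralg (grprod (fun x : I * C => d x.2 * e x.1)%g grregular) R).
Proof.
exists (mc_spread (m := grm_context) (fun _ : G => frame) C) => g M hM [[i c] k] [[i' c'] k'].
have := grm_beta_deg (q_deg i) (grm_P_lact (hM (c, k) (c', k')) (p_deg i')).
by rewrite /= !invgM !mulgA.
Defined.
End GrMorita.

Section GrRoundTrip.
Variables (R S : unital_gralgebra l G) (m : grmorita R S) (I J : finType).
Variables (e : I -> G) (p : I -> grm_P m) (q : I -> grm_Q m).
Variables (e' : J -> G) (q' : J -> grm_Q m) (p' : J -> grm_P m).
Hypotheses (p_deg : forall i, grm_Pgr (e i) (p i))
  (q_deg : forall i, grm_Qgr (e i)^-1%g (q i)).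
Hypotheses (q'_deg : forall j, grm_Qgr (e' j) (q' j))
  (p'_deg : forall j, grm_Pgr (e' j)^-1%g (p' j)).
Hypothesis frame : \sum_i grm_alpha m (tens (p i) (q i)) = grone S.
Hypothesis coframe : \sum_j grm_beta m (tens (q' j) (p' j)) = grone R.
Variables (C : finType) (d : C -> G).

Let phi := grm_spread p_deg q_deg frame d.
Let psi := grm_spread (m := grm_swap m) q'_deg p'_deg coframe
  (fun x : I * C => d x.2 * e x.1)%g.
Let C2 : finType := (C + C)%type.
Let C3 : finType := (C + J * (I * C))%type.
Let d2 (z : C2) : G := match z with inl c => d c | inr c => d c end.
Let d3 (z : C3) : G := match z with inl c => d c | inr w => d w.2.2 * e w.2.1 * e' w.1 end%g.

Definition grm_trip :
  grhom (mat_gralg (grprod d2 grregular) S) (mat_gralg (grprod d3 grregular) S).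
Proof.
exists (trip (m := grm_context m) (fun _ : G => frame) (fun _ : G => coframe) C).
move=> g M hM [z k] [z' k'].
(* With these degrees of the two coefficients, the degree of an entry telescopes to the one
   prescribed by [d3]. *)
have ha : gr ((d3 z)^-1 * d2 (trip_rho z))%g
    (trip_a (m := grm_context m) (fun i _ => q i) (fun j _ => p' j) z k).
  case: z => [c|[j [i c]]] /=; first by rewrite mulVg; apply: gr_one.
  have := grm_alpha_deg (p'_deg j) (q_deg i).
  by rewrite !invgM -!mulgA mulVg mulg1.
have hb : gr ((d2 (trip_rho z'))^-1 * d3 z')%g
    (trip_b (m := grm_context m) (fun i _ => p i) (fun j _ => q' j) z' k').
  case: z' => [c|[j [i c]]] /=; first by rewrite mulVg; apply: gr_one.
  have := grm_alpha_deg (p_deg i) (q'_deg j).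
  by rewrite !mulgA mulVg mul1g.
have := gr_mul (gr_mul ha (hM (trip_rho z, k) (trip_rho z', k'))) hb.
by rewrite /= !invgM !mulgA !mulgK.
Defined.

(** The cancellation of [gm_trip_iso]; the inclusions of the summands preserve degrees by the choice
    of [d2] and [d3]. *)
Lemma grm_trip_iso (i0 : I) (j0 : J) (c0 : C) :
  is_iso (fmap X (psi : @hom (GrAlg l G) _ _) \o fmap X (phi : @hom (GrAlg l G) _ _))%cat.
Proof.
pose Y := grmat_functor S X.
pose il2 := @grprod_map C C2 d d2 grregular _ (@inl_inj C C) (fun=> erefl).
pose ir2 := @grprod_map C C2 d d2 grregular _ (@inr_inj C C) (fun=> erefl).
pose il3 := @grprod_map C C3 d d3 grregular _ (@inl_inj C (J * (I * C))%type) (fun=> erefl).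
pose d' (w : J * (I * C)) := (d w.2.2 * e w.2.1 * e' w.1)%g.
pose ir3 := @grprod_map _ C3 d' d3 grregular _
  (@inr_inj C (J * (I * C))%type) (fun=> erefl).
have il : (fmap X (grm_trip : @hom (GrAlg l G) _ _) \o fmap Y il2)%cat = fmap Y il3.
  by rewrite -(fmap_comp X); congr (fmap X _); apply: grhom_ext => M; apply: trip_inl.
have ir : (fmap X (grm_trip : @hom (GrAlg l G) _ _) \o fmap Y ir2)%cat =
    (fmap Y ir3 \o (fmap X (psi : @hom (GrAlg l G) _ _) \o fmap X (phi : @hom (GrAlg l G) _ _)))%cat.
  by rewrite -!(fmap_comp X); congr (fmap X _); apply: grhom_ext => M; apply: trip_inr.
apply: (@is_iso_cancel_l _ _ _ _ (fmap Y ir3)).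
  by apply: (grprod_embedding_iso _ _ (((j0, (i0, c0)) : J * (I * C)))).
rewrite -ir (embeddings_eq (N := grcopies) _ ir2 il2); last by move=> T; apply: grslice_iso.
by rewrite il; apply: (grprod_embedding_iso _ _ c0).
Qed.
End GrRoundTrip.

Lemma grmorita_invariant (R S : unital_gralgebra l G) :
  grmorita R S -> isomorphic (X (ugralg R)) (X (ugralg S)).
Proof.
move=> m; apply: isomorphic_sym.
have [n [e [p [q [p_deg q_deg frame]]]]] := grm_frame m.
have [n' [e' [q' [p' [q'_deg p'_deg coframe]]]]] := grm_frame (grm_swap m).
pose C : finType := unit.
pose Z : finType := ('I_n.+1 * unit)%type.
(* The factor 1 is the degree of the point of [C], kept so that the target of [grm_spread] matches
   by conversion. *)
pose d (z : Z) : G := (1 * e z.1)%g.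
apply: isomorphic_trans (grregular_matrices S) _.
apply: (@isomorphic_trans _ _ (X (mat_gralg (grprod d grregular) R))).
  exists (fmap X (grm_spread p_deg q_deg frame (fun _ : C => 1%g) : @hom (GrAlg l G) _ _)).
  apply: is_iso_2of6
    (grm_trip_iso p_deg q_deg q'_deg p'_deg frame coframe _ ord0 ord0 tt)
    (grm_trip_iso (m := grm_swap m) q'_deg p'_deg p_deg q_deg coframe frame _ ord0 ord0
      ((ord0, tt) : Z)).
apply: isomorphic_sym.
apply: isomorphic_trans (grregular_matrices R) _.
have [f] : inhabited (grembedding (grprod (fun _ : unit => 1%g) grregular) (grprod d grregular)).
  (* Right translation by the inverse of the twist at [ord0] makes the map preserve degrees. *)
  constructor; exists (fun x => ((ord0, tt), x.2 * (d (ord0, tt))^-1)%g : grprod d grregular).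
    by move=> [[] g] [[] h] [] /mulIg ->.
  by move=> [[] g] /=; rewrite mulgVK mulg1.
by exists (fmap (grmat_functor R X) f); apply: (grprod_embedding_iso _ _ tt).
Qed.
End GrStability.
End Graded.

Theorem corollary1p2 (l : comPzRingType) (G : groupType) :
  (forall (kkG : tricat) (jG : functor (GAlg l G) kkG) (d : excisive jG),
     is_kkG d ->
     forall R S : unital_galgebra l G, gmorita R S ->
       isomorphic (jG (ugalg R)) (jG (ugalg S))) /\
  (forall (kkGr : tricat) (jGr : functor (GrAlg l G) kkGr) (d : excisive jGr),
     is_kkGr d ->
     forall R S : unital_gralgebra l G, grmorita R S ->
       isomorphic (jGr (ugralg R)) (jGr (ugralg S))).
Proof.
split=> [kk j d [[_ matN stab] _] R S | kk j d [[_ matN stab] _] R S].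
  exact: gmorita_invariant.
exact: grmorita_invariant.
Qed.
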